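(* Let $\lambda$ be a partition of a positive integer and let $K_\lambda$ be the complete multipartite graph whose partite-set sizes are the parts of $\lambda$. Then the chromatic symmetric function $X_{K_\lambda}$ is $e$-positive if and only if at least one of the following holds: (i) the partition $\lambda$ has length one (exactly one part); (ii) every part of $\lambda$ belongs to $\{1,2\}$; (iii) $\lambda=(3,2^\beta)$ for some integer $\beta\ge 1$.
   Context: The partition $(3,2^\beta)$ has one part equal to $3$ and $\beta$ parts equal to $2$. When $\lambda=(n)$ has length one, $K_\lambda$ is the edgeless graph on $n$ vertices. For a finite simple graph $G=(V,E)$, the chromatic symmetric function is $X_G(x)=\sum_{\kappa}\prod_{v\in V}x_{\kappa(v)}$, where $x=(x_1,x_2,\dots)$ are commuting indeterminates and the sum is over all proper colorings $\kappa\colon V\to\mathbb Z_{>0}$ (adjacent vertices get distinct colors). A symmetric function is $e$-positive if all coefficients in its expansion in the basis of elementary symmetric functions $e_\mu=e_{\mu_1}e_{\mu_2}\cdots$ are nonnegative. *)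

(* Defs.v *)
From HB Require Import structures.
From mathcomp Require Import all_boot all_order all_algebra all_fingroup.
From mathcomp Require Import finmap mpoly.

Set Implicit Arguments.
Unset Strict Implicit.
Unset Printing Implicit Defensive.

Import GRing.Theory Num.Theory.
Local Open Scope ring_scope.

Definition is_intpart (s : seq nat) : bool := sorted geq s && (0%N \notin s).

Record intpart : Type := IntPart {
  parts :> seq nat;
  parts_intpart : is_intpart parts }.

HB.instance Definition _ := [isSub for parts].
HB.instance Definition _ := [Countable of intpart by <:].

(* Symmetric functions over rat in infinitely many variables x_1, x_2, ...    *)
(*                                                                            *)
(* The ring of symmetric functions is taken to be the inverse limit, in the   *)
(* category of graded rings, of the rings of symmetric polynomials in N       *)
(* variables along the maps killing the last variable.  A symmetric function  *)
(* f is thus a coherent family of symmetric polynomials of bounded degree,    *)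
(* where f N stands for f(x_1, ..., x_N, 0, 0, ...).  Since each monomial     *)
(* involves finitely many variables, f is determined by this family, and      *)
(* identities between symmetric functions are to be checked for every N.      *)

Definition kill_last (N : nat) (p : {mpoly rat[N.+1]}) : {mpoly rat[N]} :=
  p \mPo [tuple if unlift ord_max i is Some j then 'X_j else 0 | i < N.+1].

Record symfun : Type := SymFun {
  sf_trunc :> forall N : nat, {mpoly rat[N]};
  sf_symmetric : forall N, sf_trunc N \is symmetric;
  sf_coherent : forall N, kill_last (sf_trunc N.+1) = sf_trunc N;
  sf_bounded : exists d, forall N, (msize (sf_trunc N) <= d)%N }.

Lemma kill_lastM N (p q : {mpoly rat[N.+1]}) :
  kill_last (p * q) = kill_last p * kill_last q.
Proof. exact: rmorphM. Qed.

Lemma kill_last_prod N (I : Type) (r : seq I) (P : pred I)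
    (F : I -> {mpoly rat[N.+1]}) :
  kill_last (\prod_(i <- r | P i) F i) = \prod_(i <- r | P i) kill_last (F i).
Proof. exact: rmorph_prod. Qed.

Lemma kill_lastXU N (i : 'I_N.+1) :
  kill_last 'X_i = if unlift ord_max i is Some j then 'X_j else 0.
Proof.
by rewrite /kill_last comp_mpolyXU -tnth_nth tnth_mktuple.
Qed.

Lemma kill_last_mwiden N (p : {mpoly rat[N]}) : kill_last (mwiden p) = p.
Proof.
rewrite [p]mpolyE raddf_sum /kill_last raddf_sum /=.
apply: eq_bigr => m _.
rewrite -mul_mpolyC rmorphM /= mwidenC mwidenX rmorphM /= comp_mpolyC.
congr (_ * _); rewrite comp_mpolyX big_ord_recr /= [X in X * _](eq_bigr
  (fun i : 'I_N => 'X_i ^+ m i)) => [|i _].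
  rewrite [X in _ * X](_ : _ = 1) ?mulr1; last first.
    by rewrite mnmwiden_ordmax expr0.
  by rewrite -mpolyXE_id.
rewrite mnmwiden_widen tnth_mktuple.
have -> : widen_ord (leqnSn N) i = lift ord_max i.
  by apply: val_inj; rewrite /= /bump leqNgt ltn_ord.
by rewrite liftK.
Qed.

Lemma kill_last_mesym N k : kill_last (mesym N.+1 rat k) = mesym N rat k.
Proof.
case: k => [|k]; first by rewrite !mesym0E /kill_last comp_mpoly1.
rewrite mesymSS /kill_last rmorphD /= -/(kill_last _) kill_last_mwiden.
by rewrite -/(kill_last _) kill_lastM kill_lastXU unlift_none mulr0 addr0.
Qed.

(* e_mu = e_{mu_1} e_{mu_2} ... *)
Section ElementarySymfun.
Variable mu : intpart.

Definition elem_trunc (N : nat) : {mpoly rat[N]} :=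
  \prod_(k <- mu) mesym N rat k.

Fact elem_symmetric N : elem_trunc N \is symmetric.
Proof. by apply: rpred_prod => k _; exact: mesym_sym. Qed.

Fact elem_coherent N : kill_last (elem_trunc N.+1) = elem_trunc N.
Proof.
by rewrite /elem_trunc kill_last_prod; apply: eq_bigr => k _; rewrite kill_last_mesym.
Qed.

Fact elem_bounded : exists d, forall N, (msize (elem_trunc N) <= d)%N.
Proof.
exists (sumn mu).+1 => N; rewrite /elem_trunc.
elim: (parts mu) => [|k s IHs]; first by rewrite big_nil msize1.
rewrite big_cons /=; set q := \prod_(j <- s) _ in IHs *.
have le_k : (msize (mesym N rat k) <= k.+1)%N.
  rewrite mesymE; apply: leq_trans (mmeasure_sum _ _ _ _) _.
  by apply/bigmax_leqP => h /eqP <-; rewrite msizeX mdeg_mesym1.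
have [->|p_neq0] := eqVneq (mesym N rat k) 0; first by rewrite mul0r msize0.
have [->|q_neq0] := eqVneq q 0; first by rewrite mulr0 msize0.
rewrite msizeM // -subn1 leq_subLR; apply: leq_trans (leq_add le_k IHs) _.
by rewrite addSn addnS add1n.
Qed.

Definition elem_symfun : symfun :=
  SymFun elem_symmetric elem_coherent elem_bounded.

End ElementarySymfun.

(* The e_mu form a basis of the symmetric functions, so c is unique if it     *)
(* exists.                                                                    *)
Definition e_expansion (f : symfun) (c : {fsfun intpart -> rat with 0}) : Prop :=
  forall N : nat, f N = \sum_(mu <- finsupp c) c mu *: elem_symfun mu N.

Definition e_positive (f : symfun) : Prop :=
  exists2 c : {fsfun intpart -> rat with 0},
    e_expansion f c & forall mu : intpart, 0 <= c mu.

Record sgraph : Type := SGraph {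
  vertex :> finType;
  edge : rel vertex;
  edge_sym : ssrbool.symmetric edge;
  edge_irrefl : irreflexive edge }.

Definition proper_coloring (G : sgraph) (C : eqType) (kappa : G -> C) : bool :=
  [forall u, forall v, edge u v ==> (kappa u != kappa v)].

Section ChromaticSymfun.
Variable G : sgraph.

Definition chrom_trunc (N : nat) : {mpoly rat[N]} :=
  \sum_(kappa : {ffun G -> 'I_N} | proper_coloring kappa) \prod_(v : G) 'X_(kappa v).

Fact chrom_symmetric N : chrom_trunc N \is symmetric.
Proof.
apply/issymP => s; rewrite /chrom_trunc raddf_sum /=.
rewrite [RHS](reindex_inj (h := fun k : {ffun G -> 'I_N} => [ffun v => s (k v)]));
  last first.
  by move=> k1 k2 /ffunP eqk; apply/ffunP => v;
    move: (eqk v); rewrite !ffunE; exact: perm_inj.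
apply: eq_big => [k|k _].
  apply/forallP/forallP => pk u; apply/forallP => v; move/forallP: (pk u) => /(_ v);
    by rewrite !ffunE (inj_eq perm_inj).
rewrite rmorph_prod /=; apply: eq_bigr => v _.
by rewrite ffunE /msym mmapX mmap1U.
Qed.

Fact chrom_coherent N : kill_last (chrom_trunc N.+1) = chrom_trunc N.
Proof.
rewrite /chrom_trunc /kill_last raddf_sum /=.
under eq_bigr do rewrite -/(kill_last _) kill_last_prod.
pose up (k : {ffun G -> 'I_N}) : {ffun G -> 'I_N.+1} := [ffun v => lift ord_max (k v)].
have up_inj : injective up.
  move=> k1 k2 /ffunP eqk; apply/ffunP => v.
  by move: (eqk v); rewrite !ffunE; apply: lift_inj.
rewrite (bigID (fun k => k \in codom up)) /= [X in _ + X]big1 ?addr0; last first.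
  move=> k /andP[_ /negP up_k].
  have [/existsP[v /eqP kv]|/existsPn nk] := boolP [exists v, k v == ord_max].
    by rewrite (bigD1 v) //= kill_lastXU kv unlift_none mul0r.
  have /fin_all_exists[k' k'E] v : exists j, k v = lift ord_max j.
    by move: (nk v); case: (unliftP ord_max (k v)) => [j -> _|->]; [exists j | rewrite eqxx].
  case: up_k; apply/codomP; exists [ffun v => k' v].
  by apply/ffunP => v; rewrite !ffunE.
rewrite (reindex_omap up (fun k => [pick k' | up k' == k])) /=; last first.
  move=> k /andP[_ /codomP[k' ->]]; case: pickP => [k2 /eqP eqk|/(_ k')] /=.
    by rewrite eqk.
  by rewrite eqxx.
apply: eq_big => [k|k _]; last first.
  by apply: eq_bigr => v _; rewrite kill_lastXU ffunE liftK.
rewrite codom_f andbT; case: pickP => [k2 /eqP/up_inj ->|/(_ k)]; last by rewrite eqxx.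
rewrite eqxx andbT; apply/forallP/forallP => pk u; apply/forallP => v;
  by move/forallP: (pk u) => /(_ v); rewrite !ffunE (inj_eq (@lift_inj _ _)).
Qed.

Fact chrom_bounded : exists d, forall N, (msize (chrom_trunc N) <= d)%N.
Proof.
exists #|G|.+1 => N; apply: leq_trans (mmeasure_sum _ _ _ _) _.
apply/bigmax_leqP => k _; rewrite mprodXE msizeX mdeg_sum.
by rewrite (eq_bigr (fun=> 1%N)) => [|v _]; rewrite ?sum1_card // mdeg1.
Qed.

(* Colours are 0-based: the N-th truncation only keeps the colourings using   *)
(* the first N colours, since the other ones contribute a killed variable.    *)
Definition chromatic_symfun : symfun :=
  SymFun chrom_symmetric chrom_coherent chrom_bounded.

End ChromaticSymfun.

Section CompleteMultipartite.
Variable la : intpart.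

Definition cm_vertex : finType := {i : 'I_(size la) & 'I_(nth 0%N la i)}.
Definition cm_edge : rel cm_vertex := fun u v => tag u != tag v.

Fact cm_edge_sym : ssrbool.symmetric cm_edge.
Proof. by move=> u v; rewrite /cm_edge eq_sym. Qed.

Fact cm_edge_irrefl : irreflexive cm_edge.
Proof. by move=> u; rewrite /cm_edge eqxx. Qed.

Definition complete_multipartite : sgraph := SGraph cm_edge_sym cm_edge_irrefl.

End CompleteMultipartite.

(* Main.v *)
(* Adding a part of size k to a complete multipartite graph acts on symmetric   *)
(* functions, viewed as families indexed by the set A of available colours:     *)
(* for k = 1 it is U f A = \sum_(c in A) x_c f(A \ c), for k = 2 it is U^2 + W2, *)
(* for k = 3 it is U^3 + 3 U W2 + W3, where Wr weights c by x_c^r.  On products  *)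
(* e_i e_j these operators are computed from e_{k+1}(A) = e_{k+1}(A \ c) +      *)
(* x_c e_k(A \ c); the first two preserve the cone spanned by the e_i e_j.      *)
(* For (3,2^n) one needs X_{(2^n)} = n! \sum_b g_b e_{n-b} e_{n+b}, with g_b     *)
(* independent of n; the negative terms of consecutive summands then telescope  *)
(* because g_{d+1} <= (6d+2) g_d for d >= 2.                                    *)
(*                                                                            *)
(* Conversely, the support of an e-positive function is closed under moving a   *)
(* unit from a larger exponent to a smaller one, while the exponents of X are   *)
(* the refinements of lambda.  Hence parts differ by at most 1                  *)
(* ((a,b) -> (a-1,b+1)), no part k >= 3 is repeated ((k,k) -> (k-1,k-1,2)), and  *)
(* (k+1,k) -> (k-1,k-1,3) excludes (k+1,k) for k >= 4.  The remaining (4,3) is   *)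
(* excluded by comparing the values 2 and 66 of X at (1,1) and (1,1,1): every    *)
(* e_mu that occurs satisfies 2 e_mu(1,1,1) >= 81 e_mu(1,1).                    *)

Require Import Defs.
From mathcomp Require Import all_boot all_order all_algebra.
From mathcomp Require Import finmap mpoly.
From mathcomp Require Import ring zify.

Set Implicit Arguments.
Unset Strict Implicit.
Unset Printing Implicit Defensive.

Import Order.TTheory GRing.Theory Num.Theory.
Local Open Scope ring_scope.

(** * Elementary symmetric sums over a set of colours *)

Section ElementarySums.
Variables (I : finType) (R : comNzRingType) (x : I -> R).
Implicit Types (A B : {set I}) (f : {set I} -> R) (i j k r : nat).

(** Colouring one part uses up a set of colours that no other part may use, so X is built from 1 by
    one operator per part, acting on functions of the set A of available colours ([chromsum_cons]).

    Positive cases. A single part gives a power of e_1. By [wsum1_eprodS], U(e_{i+1} e_j) = (j-i)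
    e_{i+1} e_{j+1} + U(e_i e_{j+1}); starting from i+1 <= j, iterating it only widens the gap
    between the indices and all coefficients are nonnegative. Hence parts of size 1 and 2 preserve
    the cone of products e_i e_j ([cone_wsum1], [cone_add2]). For (3,2^n) the expansion of X for
    (2^n) is found exactly ([iter_add2_gcoef]). Adding the part 3 to its summand number d >= 1
    leaves one negative product ([add3_eprod_even]), which for d >= 2 is cancelled by what the
    summands before it hold in reserve ([gcoef1_le], [cone_add3_partial]).

    Excluded cases. The monomials of an e-positive function admit transfers of a unit from a larger
    to a smaller exponent ([e_positive_robin_hood]). The monomials of X record sizes of colour
    classes, and with N colours and l parts at most N - l parts are split ([count_color_classes]).
    Transfers that destroy too many part sizes are therefore contradictory: [part_lt_add2] uses N =
    l, while [equal_parts_le2] and [consecutive_parts_le4] use N = l + 1. Only (4,3) escapes; it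
    falls to a count of colourings ([not_e_positive43]). *)

Definition esum k A : R :=
  \sum_(B : {set I} | (B \subset A) && (#|B| == k)) \prod_(c in B) x c.

Definition wsum r f A : R := \sum_(c in A) x c ^+ r * f (A :\ c).

Definition eprod i j A : R := esum i A * esum j A.

Lemma esum0 A : esum 0 A = 1.
Proof.
rewrite /esum (big_pred1 set0) ?big_set0 // => B.
by rewrite cards_eq0 /=; have [->|_] := eqVneq B set0; rewrite ?sub0set ?andbF.
Qed.

Lemma esumS k c A : c \in A ->
  esum k.+1 A = esum k.+1 (A :\ c) + x c * esum k (A :\ c).
Proof.
move=> cA; rewrite /esum (bigID (fun B => c \in B)) /= addrC; congr (_ + _).
  by apply: eq_bigl => B; rewrite subsetD1 andbAC.
rewrite (reindex_onto (fun B => c |: B) (fun B => B :\ c)) /=; last first.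
  by move=> B /andP[_ cB]; rewrite setD1K.
rewrite mulr_sumr; apply: eq_big => [B|B /andP[/andP[_ _] /eqP eB]].
  rewrite setU11 andbT subUset sub1set cA /= subsetD1.
  have [cB|ncB] /= := boolP (c \in B); last first.
    by rewrite cardsU1 ncB add1n eqSS setU1K // eqxx !andbT.
  rewrite !andbF /=; apply/andP=> -[_ /eqP eB].
  by move: cB; rewrite -eB !inE eqxx.
by rewrite big_setU1 //= -eB !inE eqxx.
Qed.

Lemma sum_esumD1 k A : \sum_(c in A) esum k (A :\ c) = (#|A|%:R - k%:R) * esum k A.
Proof.
rewrite /esum (exchange_big_dep (fun B => (B \subset A) && (#|B| == k))) /=; last first.
  by move=> c B _ /andP[]; rewrite subsetD1 => /andP[-> _] ->.
rewrite mulr_sumr; apply: eq_bigr => B /andP[BA /eqP cB].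
rewrite (eq_bigl (fun c => c \in A :\: B)); last first.
  by move=> c; rewrite subsetD1 BA cB eqxx andbT inE andbC.
by rewrite sumr_const -[LHS]mulr_natl cardsDS // cB natrB // -cB subset_leq_card.
Qed.

Lemma mul_esumD1 k c A : c \in A ->
  x c * esum k (A :\ c) = esum k.+1 A - esum k.+1 (A :\ c).
Proof. by move=> cA; rewrite (esumS k cA); ring. Qed.

Lemma wsum1_esum k A : wsum 1 (esum k) A = k.+1%:R * esum k.+1 A.
Proof.
under [wsum _ _ _]eq_bigr => c cA do rewrite expr1 mul_esumD1 //.
by rewrite sumrB sumr_const sum_esumD1 -[_ *+ #|A|]mulr_natl; ring.
Qed.

Lemma esum1 A : esum 1 A = \sum_(c in A) x c.
Proof.
rewrite -[LHS]mul1r -(wsum1_esum 0) /wsum.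
by apply: eq_bigr => c _; rewrite esum0 expr1 mulr1.
Qed.

Lemma eprodC i j A : eprod i j A = eprod j i A.
Proof. exact: mulrC. Qed.

(** Since x_c e_k(A \ c) = e_{k+1}(A) - e_{k+1}(A \ c), the difference of the two sums has the terms
    e_{j+1}(A) e_{i+1}(A \ c) - e_{i+1}(A) e_{j+1}(A \ c). After summation by [sum_esumD1] the
    cardinal of A cancels. *)
Lemma wsum1_eprodS i j A :
  wsum 1 (eprod i.+1 j) A =
  (j%:R - i%:R) * eprod i.+1 j.+1 A + wsum 1 (eprod i j.+1) A.
Proof.
apply/eqP; rewrite -subr_eq; apply/eqP; rewrite /wsum -sumrB.
transitivity (\sum_(c in A) (esum j.+1 A * esum i.+1 (A :\ c)
                - esum i.+1 A * esum j.+1 (A :\ c))).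
  apply: eq_bigr => c cA; rewrite /eprod (esumS j cA) (esumS i cA); ring.
by rewrite sumrB -!mulr_sumr !sum_esumD1 /eprod; ring.
Qed.

Lemma wsum1_eprodSD i k A :
  wsum 1 (eprod i.+1 (i + k)) A =
  k%:R * eprod i.+1 (i + k).+1 A + wsum 1 (eprod i (i + k).+1) A.
Proof. by rewrite wsum1_eprodS; ring. Qed.

Lemma wsum1_eprod0 j A : wsum 1 (eprod 0 j) A = j.+1%:R * eprod 0 j.+1 A.
Proof.
rewrite /eprod esum0 mul1r -wsum1_esum; apply: eq_bigr => c _.
by rewrite esum0 mul1r.
Qed.

Lemma wsum2_eprod i j A :
  wsum 2 (eprod i j) A =
  i.+1%:R * eprod i.+1 j.+1 A - wsum 1 (eprod i j.+1) A.
Proof.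
apply/eqP; rewrite eq_sym subr_eq; apply/eqP.
rewrite /eprod mulrA -wsum1_esum mulr_suml -big_split /=.
by apply: eq_bigr => c cA; rewrite (esumS j cA); ring.
Qed.

Lemma wsum3_eprod i j A :
  wsum 3 (eprod i j) A =
  esum 1 A * eprod i.+1 j.+1 A - j.+2%:R * eprod i.+1 j.+2 A
  - i.+2%:R * eprod i.+2 j.+1 A + wsum 1 (eprod i.+1 j.+1) A.
Proof.
have -> : wsum 3 (eprod i j) A = \sum_(c in A)
    (x c * (esum i.+1 A * esum j.+1 A)
     - (esum i.+1 A * (x c ^+ 1 * esum j.+1 (A :\ c))
       + esum j.+1 A * (x c ^+ 1 * esum i.+1 (A :\ c)))
     + x c ^+ 1 * eprod i.+1 j.+1 (A :\ c)).
  by apply: eq_bigr => c cA; rewrite /eprod (esumS j cA) (esumS i cA); ring.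
rewrite big_split sumrB big_split /= -mulr_suml -!mulr_sumr -esum1.
have := wsum1_esum i.+1 A; have := wsum1_esum j.+1 A; rewrite /wsum => -> ->.
by rewrite /eprod; ring.
Qed.

Lemma eq_wsum r f g A : f =1 g -> wsum r f A = wsum r g A.
Proof. by move=> fg; apply: eq_bigr => c _; rewrite fg. Qed.

Lemma wsumD r f g A : wsum r (fun B => f B + g B) A = wsum r f A + wsum r g A.
Proof. by rewrite -big_split; apply: eq_bigr => c _; rewrite mulrDr. Qed.

Lemma wsumZ r (a : R) f A : wsum r (fun B => a * f B) A = a * wsum r f A.
Proof. by rewrite mulr_sumr; apply: eq_bigr => c _; rewrite mulrCA. Qed.

Lemma wsum_sum r (J : Type) (s : seq J) (F : J -> {set I} -> R) A :
  wsum r (fun B => \sum_(j <- s) F j B) A = \sum_(j <- s) wsum r (F j) A.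
Proof.
by rewrite exchange_big /=; apply: eq_bigr => c _; rewrite mulr_sumr.
Qed.

Lemma wsum2D q r f g A :
  wsum q (wsum r (fun B => f B + g B)) A = wsum q (wsum r f) A + wsum q (wsum r g) A.
Proof. by rewrite -wsumD; apply: eq_wsum => B; exact: wsumD. Qed.

Lemma wsum2Z q r (a : R) f A :
  wsum q (wsum r (fun B => a * f B)) A = a * wsum q (wsum r f) A.
Proof. by rewrite -wsumZ; apply: eq_wsum => B; exact: wsumZ. Qed.

Lemma wsum2_sum q r (J : Type) (s : seq J) (F : J -> {set I} -> R) A :
  wsum q (wsum r (fun B => \sum_(j <- s) F j B)) A =
  \sum_(j <- s) wsum q (wsum r (F j)) A.
Proof. by rewrite -wsum_sum; apply: eq_wsum => B; exact: wsum_sum. Qed.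

Lemma eq_wsum2 q r f g A : f =1 g -> wsum q (wsum r f) A = wsum q (wsum r g) A.
Proof. by move=> fg; apply: eq_wsum => B; exact: eq_wsum. Qed.

Definition add2 f A : R := wsum 1 (wsum 1 f) A + wsum 2 f A.
Definition add3 f A : R :=
  wsum 1 (wsum 1 (wsum 1 f)) A + 3%:R * wsum 1 (wsum 2 f) A + wsum 3 f A.

Lemma add2_eprodS i k A :
  add2 (eprod i.+1 (i.+1 + k)) A =
  i.+2%:R * eprod i.+2 (i + k).+2 A + k%:R * wsum 1 (eprod i.+1 (i + k).+2) A
  + wsum 1 (wsum 1 (eprod i (i + k).+2)) A.
Proof.
rewrite /add2 wsum2_eprod (eq_wsum _ _ (wsum1_eprodS _ _)) wsumD wsumZ !addSn.
by ring.
Qed.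

Lemma add2_eprod0 k A :
  add2 (eprod 0 k) A =
  eprod 1 k.+1 A + k%:R * wsum 1 (eprod 0 k.+1) A.
Proof.
rewrite /add2 wsum2_eprod (eq_wsum _ _ (wsum1_eprod0 _)) wsumZ.
by ring.
Qed.

End ElementarySums.

(** * Products e_{m-y} e_{m+y} with a common centre m, and the expansion for (2^n) *)

Section EvenBlocks.
Variables (I : finType) (R : comNzRingType) (x : I -> R).
Implicit Types (A : {set I}) (f : {set I} -> R) (i j k b y d n : nat).
Local Notation wsum := (wsum x).
Local Notation eprod := (eprod x).
Local Notation add2 := (add2 x).
Local Notation add3 := (add3 x).

(** The value 0 at i = 0 lets [wsum1_eprod] hold for every i. *)
Definition wtail i j A : R := if i is i'.+1 then wsum 1 (eprod i' j.+1) A else 0.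

Lemma wsum1_eprod i j A :
  wsum 1 (eprod i j) A = (j.+1%:R - i%:R) * eprod i j.+1 A + wtail i j A.
Proof.
case: i => [|i]; first by rewrite wsum1_eprod0 /=; ring.
by rewrite wsum1_eprodS /=; ring.
Qed.

(** Unrolling [wsum1_eprod] keeps the centre i + b + 1 fixed; y is the distance from it, and the
    coefficient 2y is the gap between the two indices. *)
Lemma wsum1_eprod_odd i b A :
  wsum 1 (eprod i (i + b.*2.+1)) A =
  \sum_(b.+1 <= y < (i + b).+2)
    (2 * y)%:R * eprod ((i + b).+1 - y) ((i + b).+1 + y) A.
Proof.
elim: i b => [|i IHi] b; rewrite wsum1_eprod /= big_ltn ?ltnS ?leq_addl //.
  rewrite big_geq // !add0n subnn -addnn; congr (_ * eprod _ _ _ + _); last by lia.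
  by ring.
have -> : (i.+1 + b.*2.+1).+1 = (i + b.+1.*2.+1)%N by lia.
rewrite IHi (addSnnS i b); congr (_ * eprod _ _ _ + _); try lia.
by rewrite -natrB; [congr _%:R; lia | lia].
Qed.

(** The inner operator yields odd gaps 2z+1 with coefficient 2z+1, the outer one contributes 2y to
    every y > z, and the sum of 2z+1 over b <= z < y is y^2 - b^2. *)
Lemma wsum1_wsum1_eprod_even i b A :
  wsum 1 (wsum 1 (eprod i (i + b.*2))) A =
  \sum_(b.+1 <= y < (i + b).+2) (y%:R ^+ 2 - b%:R ^+ 2) *
    ((2 * y)%:R * eprod ((i + b).+1 - y) ((i + b).+1 + y) A).
Proof.
elim: i b => [|i IHi] b; rewrite (eq_wsum x 1 A (wsum1_eprod _ _)) wsumD wsumZ /=.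
  have -> : (0 + b.*2).+1 = (0 + b.*2.+1)%N by lia.
  rewrite wsum1_eprod_odd [X in _ + X]big1 => [|c _]; last by rewrite mulr0.
  by rewrite !big_nat1 -addnn; ring.
rewrite -addnS wsum1_eprod_odd mulr_sumr (addSnnS i b).
have -> : wsum 1 (wtail i.+1 (i.+1 + b.*2)) A =
    wsum 1 (wsum 1 (eprod i (i + b.+1.*2))) A.
  by apply: eq_wsum => B /=; congr (wsum 1 (eprod _ _) B); lia.
have -> : (i.+1 + b.*2.+1)%N = (i + b.+1.*2)%N by lia.
rewrite IHi [X in X + _]big_ltn ?[RHS]big_ltn; try lia.
rewrite -!addrA; congr (_ + _); last first.
  rewrite -big_split /=; apply: eq_bigr => y _.
  by rewrite -addnn !natrD; ring.
by rewrite -addnn !natrD; ring.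
Qed.

Lemma add2_eprod_even i b A :
  add2 (eprod i (i + b.*2)) A =
  i.+1%:R * eprod i.+1 (i + b.*2).+1 A +
  \sum_(b.+1 <= y < (i + b).+2) (y%:R ^+ 2 - b%:R ^+ 2 - 1) *
    ((2 * y)%:R * eprod ((i + b).+1 - y) ((i + b).+1 + y) A).
Proof.
rewrite /add2 wsum1_wsum1_eprod_even wsum2_eprod -(addnS i b.*2) wsum1_eprod_odd.
rewrite addrCA -sumrB; congr (_ + _).
by apply: eq_bigr => y _; ring.
Qed.

(* [(gcoef b).1] is the coefficient g_b, and [(gcoef y).2] the sum of the g_b with b < y. *)
Fixpoint gcoef y : nat * nat :=
  if y is y'.+1 then
    let: (g, s) := gcoef y' in
    ((if y' is 0 then 0 else (4 * y' + 1) * g + 2 * (2 * y' + 1) * s)%N, (s + g)%N)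
  else (1%N, 0%N).

Lemma gcoef2E y : (gcoef y).2 = (\sum_(0 <= b < y) (gcoef b).1)%N.
Proof.
elim: y => [|y IHy]; first by rewrite big_geq.
by rewrite big_nat_recr //= -IHy; case: (gcoef y).
Qed.

Arguments gcoef : simpl never.

Lemma gcoef1_rec y : (gcoef y.+2).1 =
  ((4 * y.+1 + 1) * (gcoef y.+1).1 + 2 * (2 * y.+1 + 1) * (gcoef y.+1).2)%N.
Proof.
rewrite -[gcoef y.+2]/(let: (g, s) := gcoef y.+1 in
  ((4 * y.+1 + 1) * g + 2 * (2 * y.+1 + 1) * s, s + g)%N).
by case: (gcoef y.+1).
Qed.

(** This sum is the form that [add2_eprod_even] calls for. Raising y to y+1 adds 2y+1 to each old
    weight and one new term of weight 2y, which is the recursion defining [gcoef]. *)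
Lemma gcoef1_sum y : (gcoef y.+1).1%:R =
  2 * \sum_(0 <= b < y.+1) (y.+1%:R ^+ 2 - b%:R ^+ 2 - 1) * (gcoef b).1%:R :> R.
Proof.
elim: y => [|y IHy]; first by rewrite big_nat1 /=; ring.
rewrite gcoef1_rec big_nat_recr //=.
rewrite (eq_bigr (fun b => (y.+1%:R ^+ 2 - b%:R ^+ 2 - 1) * (gcoef b).1%:R
    + (2 * y.+1 + 1)%:R * (gcoef b).1%:R)); last by move=> b _; ring.
rewrite big_split /= -mulr_sumr -natr_sum -gcoef2E.
have {IHy} := IHy; set S := \sum_(0 <= b < _) _.
set g := (gcoef y.+1).1; set s := (gcoef y.+1).2 => IHy.
by rewrite !mulrDr -IHy; ring.
Qed.

Lemma exchange_big_triangle n (F : nat -> nat -> R) :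
  \sum_(0 <= b < n) \sum_(b.+1 <= y < n.+1) F b y =
  \sum_(0 <= y < n.+1) \sum_(0 <= b < y) F b y.
Proof.
elim: n => [|n IHn]; first by rewrite big_nat1 !big_geq.
rewrite big_nat_recr //= [RHS]big_nat_recr //= -IHn [X in _ = _ + X]big_nat_recr //=.
rewrite big_nat1 addrA -big_split /=; congr (_ + _).
by apply: eq_big_nat => b /andP[_ bn]; rewrite big_nat_recr //= ltnW.
Qed.

(** At distance y the first term of [add2_eprod_even] gives (n+1-y) g_y, and the sums give y g_y by
    [gcoef1_sum]. The total (n+1) g_y explains the later factorial and why g_y does not depend on
    n. *)
Lemma add2_gcoef n A :
  add2 (fun B => \sum_(0 <= b < n.+1) (gcoef b).1%:R * eprod (n - b) (n + b) B) A =
  n.+1%:R * \sum_(0 <= y < n.+2) (gcoef y).1%:R * eprod (n.+1 - y) (n.+1 + y) A.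
Proof.
transitivity (\sum_(0 <= b < n.+1) (gcoef b).1%:R * add2 (eprod (n - b) (n + b)) A).
  rewrite /add2 wsum_sum wsum2_sum -big_split; apply: eq_bigr => b _ /=.
  by rewrite wsumZ wsum2Z mulrDr.
transitivity (\sum_(0 <= b < n.+1)
    ((gcoef b).1%:R * ((n.+1%:R - b%:R) * eprod (n.+1 - b) (n.+1 + b) A) +
     \sum_(b.+1 <= y < n.+2) (y%:R ^+ 2 - b%:R ^+ 2 - 1) * (gcoef b).1%:R *
       ((2 * y)%:R * eprod (n.+1 - y) (n.+1 + y) A))).
  apply: eq_big_nat => b /andP[_]; rewrite ltnS => bn.
  have -> : (n + b)%N = (n - b + b.*2)%N by lia.
  rewrite add2_eprod_even mulrDr mulr_sumr subnK // subSn // -natrB; last by lia.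
  rewrite subSn //; congr (_ * (_ * eprod _ _ A) + _); first by lia.
  by apply: eq_bigr => y _; rewrite -!mulrA mulrCA !mulrA.
rewrite big_split /= exchange_big_triangle.
have -> : \sum_(0 <= b < n.+1)
      (gcoef b).1%:R * ((n.+1%:R - b%:R) * eprod (n.+1 - b) (n.+1 + b) A) =
    \sum_(0 <= b < n.+2)
      (gcoef b).1%:R * ((n.+1%:R - b%:R) * eprod (n.+1 - b) (n.+1 + b) A).
  by rewrite [RHS]big_nat_recr //= subrr mul0r mulr0 addr0.
rewrite -big_split /= mulr_sumr; apply: eq_bigr => y _.
rewrite -mulr_suml; case: y => [|y]; first by rewrite big_geq //; ring.
by rewrite gcoef1_sum; ring.
Qed.

Lemma iter_add2_gcoef n A :
  iter n add2 (fun=> 1) A =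
  n`!%:R * \sum_(0 <= b < n.+1) (gcoef b).1%:R * eprod (n - b) (n + b) A.
Proof.
elim: n A => [|n IHn] A; first by rewrite big_nat1 /eprod !esum0 /= !mul1r.
rewrite iterS /add2 (eq_wsum x 2 A IHn) (eq_wsum2 x 1 1 A IHn).
rewrite wsum2Z wsumZ -mulrDr -/(add2 _ A).
by rewrite add2_gcoef factS natrM; ring.
Qed.

Lemma eq_add3 f g A : f =1 g -> add3 f A = add3 g A.
Proof.
move=> fg; rewrite /add3 (eq_wsum2 x 1 2 A fg) (eq_wsum x 3 A fg).
by congr (_ + _ + _); apply: eq_wsum => B; exact: eq_wsum2.
Qed.

Lemma add3Z (a : R) f A : add3 (fun B => a * f B) A = a * add3 f A.
Proof.
have e : wsum 1 (wsum 1 (wsum 1 (fun B => a * f B))) A =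
    a * wsum 1 (wsum 1 (wsum 1 f)) A.
  by rewrite -wsumZ; apply: eq_wsum => B; exact: wsum2Z.
by rewrite /add3 e wsum2Z wsumZ; ring.
Qed.

Lemma add3_sum (J : Type) (s : seq J) (F : J -> {set I} -> R) A :
  add3 (fun B => \sum_(j <- s) F j B) A = \sum_(j <- s) add3 (F j) A.
Proof.
rewrite /add3 wsum2_sum wsum_sum !big_split /= -mulr_sumr; congr (_ + _ + _).
by rewrite -wsum_sum; apply: eq_wsum => B; exact: wsum2_sum.
Qed.

Lemma add3_iter_add2 n A :
  add3 (iter n add2 (fun=> 1)) A =
  n`!%:R * \sum_(0 <= b < n.+1) (gcoef b).1%:R * add3 (eprod (n - b) (n + b)) A.
Proof.
rewrite (eq_add3 A (iter_add2_gcoef n)) add3Z add3_sum.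
by under eq_bigr do rewrite add3Z.
Qed.

Lemma wsum1_wsum2_eprod i j A :
  wsum 1 (wsum 2 (eprod i j)) A =
  i.+1%:R * wsum 1 (eprod i.+1 j.+1) A - wsum 1 (wsum 1 (eprod i j.+1)) A.
Proof.
rewrite (eq_wsum x 1 A (wsum2_eprod _ _ _)) -wsumZ -sumrB.
by apply: eq_bigr => c _; rewrite mulrBr.
Qed.

(** The only negative product is moved to the left. For the block e_{n-d} e_{n+d}, with d = b+1 and
    n = i+d, it is (n-d+2) e_{n-d+2} e_{n+d+1}. The first product on the right, (6d+2)(n-d+1)
    e_{n-d+1} e_{n+d+2}, is the one that block d+1 subtracts, up to its coefficient. *)
Lemma add3_eprod_even i b A :
  add3 (eprod i (i + b.+1.*2)) A + i.+2%:R * eprod i.+2 (i + b.+1.*2).+1 A =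
  ((6 * b.+1 + 2) * i.+1)%:R * eprod i.+1 (i + b.+1.*2).+2 A +
  (esum x 1 A * eprod i.+1 (i + b.+1.*2).+1 A +
   (3 * i + 4)%:R * wsum 1 (eprod i (i + b.+1.*2).+2) A +
   b.*2%:R * wsum 1 (wsum 1 (eprod i (i + b.+1.*2).+1)) A +
   wsum 1 (wsum 1 (wtail i (i + b.+1.*2))) A).
Proof.
rewrite /add3 wsum3_eprod wsum1_wsum2_eprod.
rewrite (eq_wsum2 x 1 1 A (wsum1_eprod _ _)) wsum2D wsum2Z.
by rewrite (wsum1_eprod i.+1) /= -!addnn; ring.
Qed.

(** Here n = i+1 and nothing is negative. Of the total 9(i+1) e_{i+1} e_{i+4}, the share 6(i+1) is
    set apart to absorb the negative product of block 2, as g_2 = 6. *)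
Lemma add3_eprod_diag i A :
  add3 (eprod i.+1 i.+1) A =
  (6 * i.+1)%:R * eprod i.+1 i.+4 A +
  (i.+1%:R * eprod i.+2 i.+3 A + (3 * i.+1)%:R * eprod i.+1 i.+4 A +
   esum x 1 A * eprod i.+2 i.+2 A + (3 * i.+1)%:R * wsum 1 (eprod i i.+4) A +
   wsum 1 (wsum 1 (eprod i i.+3)) A + wsum 1 (wsum 1 (wtail i i.+2)) A).
Proof.
rewrite /add3 wsum3_eprod wsum1_wsum2_eprod.
rewrite (eq_wsum2 x 1 1 A (wsum1_eprod _ _)) wsum2D wsum2Z /=.
rewrite (eq_wsum2 x 1 1 A (wsum1_eprod i _)) wsum2D wsum2Z /=.
rewrite (eq_wsum x 1 A (wsum1_eprod _ _)) wsumD wsumZ /=.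
rewrite (wsum1_eprod i.+2) /= (wsum1_eprod i.+1) /=.
by rewrite (eprodC x i.+3); ring.
Qed.
End EvenBlocks.

(** * Cones of e-positive families *)

Definition setfam := forall N : nat, {set 'I_N} -> {mpoly rat[N]}.

Definition var (N : nat) (i : 'I_N) : {mpoly rat[N]} := 'X_i.

Definition elem_fam (mu : seq nat) : setfam :=
  fun N A => \prod_(k <- mu) esum (@var N) k A.

(** Members are finite sums of [elem_fam] terms with repetition, so no coefficients are carried. An
    index list may be unsorted and contain 0; [intpart_of] normalises it at the end. [cone_ext]
    stands in for functional extensionality. *)
Inductive cone (P : pred (seq nat)) : setfam -> Prop :=
| cone_elem mu : P mu -> cone P (elem_fam mu)
| cone_zero : cone P (fun N A => 0)
| cone_add f g : cone P f -> cone P g -> cone P (fun N A => f N A + g N A)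
| cone_ext f g : (forall N A, f N A = g N A) -> cone P f -> cone P g.

Definition two_rowed (mu : seq nat) : bool := size mu == 2.

Section Cone.
Variable P : pred (seq nat).
Implicit Types f g : setfam.

Lemma cone_natmul f n : cone P f -> cone P (fun N A => n%:R * f N A).
Proof.
move=> Pf; elim: n => [|n IHn].
  by apply: cone_ext (cone_zero P) => N A; rewrite mul0r.
by apply: cone_ext (cone_add Pf IHn) => N A; rewrite mulrS mulrDl mul1r.
Qed.

Lemma cone_mono (Q : pred (seq nat)) f :
  (forall mu, P mu -> Q mu) -> cone P f -> cone Q f.
Proof.
move=> PQ; elim=> [mu /PQ|| |] *; first exact: cone_elem.
- exact: cone_zero.
- exact: cone_add.
- exact: cone_ext.
Qed.

Lemma cone_seq f : cone P f -> exists s : seq (seq nat),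
  forall N A, f N A = \sum_(mu <- s) elem_fam mu A.
Proof.
elim=> [mu _||{}f g _ [s fE] _ [t gE]|{}f g fg _ [s fE]].
- by exists [:: mu] => N A; rewrite big_seq1.
- by exists [::] => N A; rewrite big_nil.
- by exists (s ++ t) => N A; rewrite big_cat fE gE.
- by exists s => N A; rewrite -fg.
Qed.

End Cone.

Definition fam_wsum r (f : setfam) : setfam := fun N A => wsum (@var N) r (f N) A.
Definition fam_eprod i j : setfam := fun N A => eprod (@var N) i j A.

Lemma cone_eprod i j : cone two_rowed (fam_eprod i j).
Proof.
apply: cone_ext (@cone_elem two_rowed [:: i; j] isT) => N A.
by rewrite /elem_fam big_cons big_seq1.
Qed.

Lemma cone_wsum1_eprod i j : (i <= j)%N ->
  cone two_rowed (fam_wsum 1 (fam_eprod i j)).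
Proof.
elim: i j => [|i IHi] j ij.
  by apply: cone_ext (cone_natmul j.+1 (cone_eprod 0 j.+1)) => N A;
    rewrite /fam_wsum /fam_eprod wsum1_eprod0.
move: ij => /ltnW/subnKC; move: (j - i)%N => k <-.
apply: cone_ext (cone_add (cone_natmul k (cone_eprod i.+1 (i + k).+1))
  (IHi (i + k).+1 _)) => [N A|]; last by rewrite -addnS leq_addr.
exact/esym/wsum1_eprodSD.
Qed.

Lemma cone_wsum1 f : cone two_rowed f -> cone two_rowed (fam_wsum 1 f).
Proof.
elim=> [mu||{}f g _ Pf _ Pg|{}f g fg _ Pf].
- case: mu => [|i [|j [|]]] // _; wlog ij : i j / (i <= j)%N => [hwlog|].
    have [/hwlog //|/ltnW /hwlog] := leqP i j.
    by apply: cone_ext => N A; apply: eq_wsum => B; rewrite /elem_fam !big_cons mulrCA.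
  apply: cone_ext (cone_wsum1_eprod ij) => N A; apply: eq_wsum => B.
  by rewrite /elem_fam big_cons big_seq1.
- by apply: cone_ext (cone_zero _) => N A; rewrite /fam_wsum /wsum big1 // => *; rewrite mulr0.
- by apply: cone_ext (cone_add Pf Pg) => N A; rewrite /fam_wsum -wsumD.
- by apply: cone_ext Pf => N A; apply: eq_wsum => B; exact: fg.
Qed.

Definition fam_add2 (f : setfam) : setfam := fun N A => add2 (@var N) (f N) A.
Definition fam_add3 (f : setfam) : setfam := fun N A => add3 (@var N) (f N) A.

Lemma cone_add2_eprod i j : (i <= j)%N -> cone two_rowed (fam_add2 (fam_eprod i j)).
Proof.
move=> /subnKC <-; move: (j - i)%N => k; case: i => [|i].
  apply: cone_ext (cone_add (cone_eprod 1 k.+1)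
    (cone_natmul k (cone_wsum1 (cone_eprod 0 k.+1)))) => N A.
  by rewrite /fam_add2 /fam_eprod add2_eprod0.
apply: cone_ext (cone_add (cone_add (cone_natmul i.+2 (cone_eprod i.+2 (i + k).+2))
    (cone_natmul k (cone_wsum1 (cone_eprod i.+1 (i + k).+2))))
  (cone_wsum1 (cone_wsum1 (cone_eprod i (i + k).+2)))) => N A.
by rewrite /fam_add2 /fam_eprod add2_eprodS.
Qed.

Lemma eq_add2 (f g : setfam) N A : (forall B, f N B = g N B) ->
  fam_add2 f A = @fam_add2 g N A.
Proof. by move=> fg; rewrite /fam_add2 /add2 (eq_wsum _ 2 A fg) (eq_wsum2 _ 1 1 A fg). Qed.

Lemma cone_add2 f : cone two_rowed f -> cone two_rowed (fam_add2 f).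
Proof.
elim=> [mu||{}f g _ Pf _ Pg|{}f g fg _ Pf].
- case: mu => [|i [|j [|]]] // _; wlog ij : i j / (i <= j)%N => [hwlog|].
    have [/hwlog //|/ltnW /hwlog] := leqP i j.
    by apply: cone_ext => N A; apply: eq_add2 => B; rewrite /elem_fam !big_cons mulrCA.
  apply: cone_ext (cone_add2_eprod ij) => N A; apply: eq_add2 => B.
  by rewrite /elem_fam big_cons big_seq1.
- apply: cone_ext (cone_zero _) => N A; rewrite /fam_add2 /add2 /wsum.
  by rewrite !big1 ?addr0 // => c _; rewrite ?big1 ?mulr0 // => d _; rewrite mulr0.
- apply: cone_ext (cone_add Pf Pg) => N A.
  by rewrite /fam_add2 /add2 addrACA -wsum2D -wsumD.
- by apply: cone_ext Pf => N A; apply: eq_add2 => B; exact: fg.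
Qed.

(** * Positivity for (3,2^n): growth of g_b and telescoping *)

Lemma cone_wtail i j : (i <= j.+1)%N ->
  cone two_rowed (fun N A => wtail (@var N) i j A).
Proof.
case: i => [|i] ij; first exact: cone_zero.
exact: cone_wsum1 (cone_eprod i j.+1).
Qed.

(** The base is d = 2, with g = 6 and s = 1; at d = 1 the bound fails because g_1 = 0. *)
Lemma gcoef2_le d : (1 < d)%N -> (2 * (gcoef d).2 <= (gcoef d).1)%N.
Proof.
elim: d => [|[|[|d]] IHd] // _.
have {IHd} := IHd isT; rewrite gcoef1_rec.
rewrite -[gcoef d.+3]/(let: (g, s) := gcoef d.+2 in
  ((4 * d.+2 + 1) * g + 2 * (2 * d.+2 + 1) * s, s + g)%N).
case: (gcoef d.+2) => g s /=; nia.
Qed.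

(** Replacing 2s by g in the recursion gives the factor (4d+1) + (2d+1). *)
Lemma gcoef1_le d : (1 < d)%N -> ((gcoef d.+1).1 <= (6 * d + 2) * (gcoef d).1)%N.
Proof.
case: d => [|d] // d1; rewrite gcoef1_rec.
by have := gcoef2_le d1; case: (gcoef d.+1) => g s /=; nia.
Qed.

Local Notation everything := (predT : pred (seq nat)).

Lemma cone_two_rowed f : cone two_rowed f -> cone everything f.
Proof. exact: cone_mono. Qed.

Lemma cone_esum1_eprod i j :
  cone everything (fun N A => esum (@var N) 1 A * eprod (@var N) i j A).
Proof.
apply: cone_ext (@cone_elem everything [:: 1%N; i; j] isT) => N A.
by rewrite /elem_fam !big_cons big_nil mulr1.
Qed.

(** E is the product in reserve, which cancels the negative part of the next block X; h E' is the
    reserve handed on, and the surplus k E' joins the remainder. *)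
Lemma telescope_step (R : comNzRingType) (X E E' p q : R) (g a c h k : nat) :
  X + a%:R * E = c%:R * E' + q -> (h + k = g * c)%N ->
  (g * a)%:R * E + p + g%:R * X = h%:R * E' + (k%:R * E' + g%:R * q + p).
Proof.
move=> /(canRL (addrK _)) -> hk.
have gcE : g%:R * c%:R = h%:R + k%:R :> R by rewrite -natrM -natrD hk.
transitivity (g%:R * c%:R * E' + g%:R * q + p); first by ring.
by rewrite gcE; ring.
Qed.

(* Each block is negative only in its neighbouring coefficient, which the       *)
(* previous block compensates since [gcoef1_le] holds.                          *)
Lemma cone_add3_partial n d : (0 < d <= n)%N -> exists2 p, cone everything p &
  forall N A,
    \sum_(0 <= b < d.+1) (gcoef b).1%:R * @fam_add3 (fam_eprod (n - b) (n + b)) N A =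
    ((gcoef d.+1).1 * (n.+1 - d))%:R * @fam_eprod (n.+1 - d) (n + d).+2 N A + p N A.
Proof.
elim: d => [//|[_ n0|d IHd dn]].
  (* The induction starts at d = 1 because g_2 <= 8 g_1 fails: block 1 vanishes, and the reserve for
     block 2 comes from block 0. *)
  case: n n0 => // i _.
  pose p N A : {mpoly rat[N]} :=
    i.+1%:R * eprod (@var N) i.+2 i.+3 A +
    (3 * i.+1)%:R * eprod (@var N) i.+1 i.+4 A +
    esum (@var N) 1 A * eprod (@var N) i.+2 i.+2 A +
    (3 * i.+1)%:R * wsum (@var N) 1 (eprod (@var N) i i.+4) A +
    wsum (@var N) 1 (wsum (@var N) 1 (eprod (@var N) i i.+3)) A +
    wsum (@var N) 1 (wsum (@var N) 1 (wtail (@var N) i i.+2)) A.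
  exists p => [|N A].
    apply: cone_add; last first.
      apply/cone_two_rowed/(cone_wsum1 (cone_wsum1 (@cone_wtail i i.+2 _))); lia.
    apply: cone_add; last first.
      exact/cone_two_rowed/(cone_wsum1 (cone_wsum1 (cone_eprod i i.+3))).
    apply: cone_add; last first.
      exact/cone_two_rowed/(cone_natmul _ (cone_wsum1 (cone_eprod i i.+4))).
    apply: cone_add; last exact: cone_esum1_eprod.
    apply: cone_add; apply/cone_two_rowed/cone_natmul.
      exact: (cone_eprod i.+2 i.+3).
    exact: (cone_eprod i.+1 i.+4).
  rewrite !big_nat_recr //= big_geq // !subSS !subn0 addn0 add0r.
  rewrite [X in (X * i.+1)%:R](_ : _ = 6%N) // mul0r addr0 mul1r addn1.
  exact: add3_eprod_diag.
have [p pP pE] := IHd (ltnW dn).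
have [i nE] : exists i, n = (i + d.+2)%N by exists (n - d.+2)%N; rewrite subnK.
pose q N A : {mpoly rat[N]} :=
  esum (@var N) 1 A * eprod (@var N) i.+1 (i + d.+2.*2).+1 A +
  (3 * i + 4)%:R * wsum (@var N) 1 (eprod (@var N) i (i + d.+2.*2).+2) A +
  d.+1.*2%:R * wsum (@var N) 1 (wsum (@var N) 1 (eprod (@var N) i (i + d.+2.*2).+1)) A +
  wsum (@var N) 1 (wsum (@var N) 1 (wtail (@var N) i (i + d.+2.*2))) A.
have qP : cone everything q.
  apply: cone_add; last first.
    apply/cone_two_rowed/(cone_wsum1 (cone_wsum1 (@cone_wtail i (i + d.+2.*2) _))); lia.
  apply: cone_add; last first.
    exact/cone_two_rowed/(cone_natmul _ (cone_wsum1 (cone_wsum1 (cone_eprod _ _)))).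
  apply: cone_add; first exact: cone_esum1_eprod.
  exact/cone_two_rowed/(cone_natmul _ (cone_wsum1 (cone_eprod _ _))).
pose g := (gcoef d.+2).1; pose h := ((gcoef d.+3).1 * i.+1)%N.
have hg : (h <= g * ((6 * d.+2 + 2) * i.+1))%N.
  by rewrite /h mulnA leq_mul2r mulnC gcoef1_le.
pose k := (g * ((6 * d.+2 + 2) * i.+1) - h)%N.
exists (fun N A => k%:R * @fam_eprod i.+1 (i + d.+2.*2).+2 N A + g%:R * q N A + p N A).
  apply: cone_add => //; apply: cone_add; last exact: cone_natmul.
  exact/cone_two_rowed/cone_natmul/cone_eprod.
move=> N A; rewrite big_nat_recr // pE nE.
have -> : (i + d.+2 - d.+2)%N = i by lia.
have -> : (i + d.+2 + d.+2)%N = (i + d.+2.*2)%N by lia.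
have -> : ((i + d.+2).+1 - d.+2)%N = i.+1 by lia.
have -> : ((i + d.+2).+1 - d.+1)%N = i.+2 by lia.
have -> : (i + d.+2 + d.+1).+2 = (i + d.+2.*2).+1 by lia.
apply: telescope_step; last exact: subnKC.
exact: add3_eprod_even.
Qed.

Lemma cone_add3_iter n : (0 < n)%N ->
  cone everything (fam_add3 (fun N A => iter n (add2 (@var N)) (fun=> 1) A)).
Proof.
move=> n0; have [p pP pE] := @cone_add3_partial n n (introT andP (conj n0 (leqnn n))).
have Ep : cone everything (fun N A =>
    ((gcoef n.+1).1 * (n.+1 - n))%:R * @fam_eprod (n.+1 - n) (n + n).+2 N A + p N A).
  by apply: cone_add => //; exact/cone_two_rowed/cone_natmul/cone_eprod.
apply: cone_ext (cone_natmul n`! Ep) => N A; rewrite -pE.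
exact/esym/add3_iter_add2.
Qed.

(** * Colouring one part at a time *)

Section Colorings.
Variables (I : finType) (R : comNzRingType) (x : I -> R).
Implicit Types (A D : {set I}) (f : {set I} -> R) (s : seq nat).
Local Notation wsum := (wsum x).

(** D holds the colours that the part already uses: its remaining k vertices may repeat them, but f
    may not. Carrying D allows recursion on the vertices of the part. *)
Definition addpart_from D k f A : R :=
  \sum_(g : {ffun 'I_k -> I} | [forall p, g p \in A])
    (\prod_p x (g p)) * f (A :\: (D :|: [set g p | p : 'I_k])).

Definition addpart := addpart_from set0.

Lemma addpart_from0 D f A : addpart_from D 0 f A = f (A :\: D).
Proof.
rewrite /addpart_from (big_pred1 (ffun0 (card_ord 0))) => [|g]; last first.
  by rewrite /=; apply/forallP/eqP => [_|-> [] //]; apply/ffunP => -[].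
rewrite big_ord0 mul1r; congr (f (_ :\: _)); apply/setP => c.
by rewrite in_setU; apply/orP/idP => [[//|/imsetP[[]]]|cD] //; left.
Qed.

Definition ffun_cons k (p : I * {ffun 'I_k -> I}) : {ffun 'I_k.+1 -> I} :=
  [ffun i => if unlift ord0 i is Some j then p.2 j else p.1].

Lemma ffun_cons_bij k : bijective (@ffun_cons k).
Proof.
pose uncons (g : {ffun 'I_k.+1 -> I}) : I * {ffun 'I_k -> I} :=
  (g ord0, [ffun j => g (lift ord0 j)]).
exists uncons => [[c g]|g].
  by rewrite /uncons ffunE unlift_none; congr (_, _); apply/ffunP => j; rewrite !ffunE liftK.
by apply/ffunP => i; rewrite ffunE; case: unliftP => [j|] -> //; rewrite ffunE.
Qed.

Lemma addpart_fromS D k f A :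
  addpart_from D k.+1 f A = \sum_(c in A) x c * addpart_from (c |: D) k f A.
Proof.
rewrite /addpart_from (reindex (@ffun_cons k)) /=; last exact/onW_bij/ffun_cons_bij.
under [RHS]eq_bigr do rewrite mulr_sumr.
rewrite pair_big_dep /=; apply: eq_big => [[c g]|[c g] _] /=.
  apply/forallP/andP => [gA|[cA /forallP gA] i].
    split; first by have := gA ord0; rewrite ffunE unlift_none.
    by apply/forallP => j; have := gA (lift ord0 j); rewrite ffunE liftK.
  by rewrite ffunE; case: unliftP => [j|] _.
rewrite big_ord_recl ffunE unlift_none /= -mulrA; congr (_ * (_ * f (_ :\: _))).
  by apply: eq_bigr => j _; rewrite ffunE liftK.
rewrite (setUC [set c]) -setUA; congr (_ :|: _); apply/setP => d; rewrite in_setU1.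
apply/imsetP/orP => [[i _ ->]|[/eqP ->|/imsetP[j _ ->]]].
- rewrite ffunE; case: unliftP => [j|] _ /=; [right|by left].
  by apply/imsetP; exists j.
- by exists ord0; rewrite // ffunE unlift_none.
- by exists (lift ord0 j); rewrite // ffunE liftK.
Qed.

Lemma addpart1 f A : addpart 1 f A = wsum 1 f A.
Proof.
rewrite /addpart addpart_fromS; apply: eq_bigr => c _.
by rewrite addpart_from0 setU0.
Qed.

Lemma addpart2 f A : addpart 2 f A = add2 x f A.
Proof.
rewrite /addpart addpart_fromS /add2 -big_split; apply: eq_bigr => c cA /=.
rewrite addpart_fromS (big_setD1 c cA) /= addpart_from0 setU0 setUid.
rewrite expr1 mulrDr addrC mulrA expr2; congr (_ + _); congr (_ * _).
apply: eq_bigr => d _; rewrite expr1 addpart_from0; congr (_ * f _).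
by rewrite setUC setDDl.
Qed.

Lemma wsumC q r f A : wsum q (wsum r f) A = wsum r (wsum q f) A.
Proof.
have swap a b : wsum a (wsum b f) A = \sum_(c in A) \sum_(d in A | d != c)
    x c ^+ a * x d ^+ b * f (A :\: [set c; d]).
  apply: eq_bigr => c cA; rewrite mulr_sumr; apply: eq_big => [d|d _].
    by rewrite in_setD1 andbC.
  by rewrite mulrA setDDl.
rewrite !swap (exchange_big_dep (fun d => d \in A)) /=; last by move=> c d _ /andP[].
apply: eq_bigr => d dA; apply: eq_big => [c|c _]; first by rewrite dA eq_sym.
by rewrite (mulrC (x c ^+ q)) setUC.
Qed.

(** Three vertices are partitioned by colour into three classes in one way, two classes in three
    ways, one class in one way; [wsumC] identifies the three middle terms. *)
Lemma addpart3 f A : addpart 3 f A = add3 x f A.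
Proof.
have -> : add3 x f A = wsum 1 (wsum 1 (wsum 1 f)) A + wsum 1 (wsum 2 f) A +
    wsum 2 (wsum 1 f) A + wsum 2 (wsum 1 f) A + wsum 3 f A.
  by rewrite /add3 (wsumC 2 1); ring.
rewrite /addpart addpart_fromS /wsum -!big_split; apply: eq_bigr => c cA /=.
rewrite addpart_fromS (big_setD1 c cA) /= setU0 setUid.
rewrite addpart_fromS (big_setD1 c cA) /= addpart_from0 setUid.
have -> : \sum_(d in A :\ c) x d * addpart_from [set d; c] 1 f A =
  \sum_(d in A :\ c) (x c * (x d * f (A :\ c :\ d)) + x d ^+ 2 * f (A :\ c :\ d) +
   x d * \sum_(e in A :\ c :\ d) x e * f (A :\ c :\ d :\ e)).
  apply: eq_bigr => d; rewrite in_setD1 => /andP[dc dA].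
  rewrite addpart_fromS (big_setD1 c cA) (big_setD1 d) /= ?in_setD1 ?dc //.
  rewrite !addpart_from0.
  have -> : c |: [set d; c] = [set c; d] by rewrite setUCA setUid setUC.
  have -> : d |: [set d; c] = [set c; d] by rewrite setUA setUid setUC.
  rewrite -setDDl !mulrDr !addrA; congr (_ + _ + _); first by ring.
    by ring.
  congr (_ * _); apply: eq_bigr => e _; rewrite addpart_from0 !setDDl.
  by rewrite setUCA (setUC [set e]) setUCA.
rewrite !big_split /= -mulr_sumr.
have -> : \sum_(d in A :\ c) x d * addpart_from [set d; c] 0 f A =
    \sum_(d in A :\ c) x d * f (A :\ c :\ d).
  by apply: eq_bigr => d _; rewrite addpart_from0 setUC setDDl.
set S1 := \sum_(d in A :\ c) x d * f (A :\ c :\ d).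
set S2 := \sum_(d in A :\ c) x d ^+ 2 * _.
set S3 := \sum_(d in A :\ c) x d * \sum_(e in _) _.
transitivity (x c * S3 + x c * S2 + x c ^+ 2 * S1 + x c ^+ 2 * S1 + x c ^+ 3 * f (A :\ c)).
  by ring.
by [].
Qed.

End Colorings.

(** * Splitting the first part off the vertex set, and the sum over colourings *)

Definition cm_vertices (s : seq nat) : finType := {i : 'I_(size s) & 'I_(nth 0%N s i)}.

Section VertexCons.
Variables (k : nat) (s : seq nat).

Definition vertex_head (p : 'I_k) : cm_vertices (k :: s) :=
  existT (fun i : 'I_(size s).+1 => 'I_(nth 0%N (k :: s) i)) ord0 p.

Definition vertex_behead (v : cm_vertices s) : cm_vertices (k :: s) :=
  let: existT (Ordinal m lt_m) p := v in
  existT (fun i : 'I_(size s).+1 => 'I_(nth 0%N (k :: s) i)) (@Ordinal (size s).+1 m.+1 lt_m) p.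

Lemma existT_ord_irr n (T : nat -> Type) m (lt1 lt2 : (m < n)%N) (p : T m) :
  existT (fun i : 'I_n => T i) (Ordinal lt1) p =
  existT (fun i : 'I_n => T i) (Ordinal lt2) p.
Proof. by rewrite (bool_irrelevance lt1 lt2). Qed.

Lemma vertex_consP (P : cm_vertices (k :: s) -> Prop) :
  (forall p, P (vertex_head p)) -> (forall v, P (vertex_behead v)) -> forall v, P v.
Proof.
move=> Phead Pbehead [[[|m] lt_m] p].
  by rewrite (@existT_ord_irr _ (fun m => 'I_(nth 0%N (k :: s) m)) _ _ (ltn0Sn _)); exact: Phead.
exact: (Pbehead (existT (fun i : 'I_(size s) => 'I_(nth 0%N s i)) (@Ordinal (size s) m lt_m) p)).
Qed.

Lemma tag_vertex_behead v : tag (vertex_behead v) = lift ord0 (tag v).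
Proof. by apply: val_inj; case: v => -[]. Qed.

Definition vertex_cons_fun (I : Type) (g : 'I_k -> I) (h : cm_vertices s -> I)
    (v : cm_vertices (k :: s)) : I :=
  let: existT (Ordinal m lt_m) p := v in
  match m return forall lt_m : (m < (size s).+1)%N, 'I_(nth 0%N (k :: s) m) -> I with
  | 0 => fun _ p => g p
  | m'.+1 => fun lt_m' p =>
      h (existT (fun i : 'I_(size s) => 'I_(nth 0%N s i)) (@Ordinal (size s) m' lt_m') p)
  end lt_m p.

Lemma vertex_cons_fun_behead I (g : 'I_k -> I) h v :
  vertex_cons_fun g h (vertex_behead v) = h v.
Proof. by case: v => -[m lt_m] p. Qed.

Lemma big_vertex_cons (R : comNzRingType) (F : cm_vertices (k :: s) -> R) :
  \prod_v F v = (\prod_p F (vertex_head p)) * \prod_v F (vertex_behead v).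
Proof.
transitivity (\prod_(i : 'I_(size s).+1) \prod_(p : 'I_(nth 0%N (k :: s) i))
    F (existT (fun i : 'I_(size s).+1 => 'I_(nth 0%N (k :: s) i)) i p)).
  rewrite sig_big_dep /=; apply: eq_bigr => -[i p] _ //.
rewrite big_ord_recl; congr (_ * _).
transitivity (\prod_(i : 'I_(size s)) \prod_(p : 'I_(nth 0%N s i))
    F (vertex_behead (existT (fun i : 'I_(size s) => 'I_(nth 0%N s i)) i p))); last first.
  rewrite sig_big_dep /=; apply: eq_bigr => -[i p] _ //.
apply: eq_bigr => -[m lt_m] _; apply: eq_bigr => p _; congr F.
exact: (@existT_ord_irr _ (fun m => 'I_(nth 0%N (k :: s) m))).
Qed.

End VertexCons.

Section ChromSum.
Variables (I : finType) (R : comNzRingType) (x : I -> R).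
Implicit Types (A : {set I}) (s : seq nat).

Definition cm_proper s (h : cm_vertices s -> I) : bool :=
  [forall u, forall v, (tag u != tag v) ==> (h u != h v)].

Definition chromsum s A : R :=
  \sum_(h : {ffun cm_vertices s -> I} | cm_proper h && [forall v, h v \in A])
    \prod_v x (h v).

Definition ffun_vertex_cons k s (p : {ffun 'I_k -> I} * {ffun cm_vertices s -> I}) :
    {ffun cm_vertices (k :: s) -> I} := [ffun v => vertex_cons_fun p.1 p.2 v].

Lemma ffun_vertex_cons_bij k s : bijective (@ffun_vertex_cons k s).
Proof.
pose inv (h : {ffun cm_vertices (k :: s) -> I}) :
    {ffun 'I_k -> I} * {ffun cm_vertices s -> I} :=
  ([ffun p => h (vertex_head s p)], [ffun v => h (vertex_behead k v)]).
exists inv => [[g h]|h].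
  by congr (_, _); apply/ffunP => v; rewrite !ffunE ?vertex_cons_fun_behead.
apply/ffunP; apply: vertex_consP => v; rewrite ffunE ?vertex_cons_fun_behead /= ffunE //.
Qed.

Lemma chromsum_nil A : chromsum [::] A = 1.
Proof.
have noV (v : cm_vertices [::]) : False by case: v => -[].
rewrite /chromsum (big_pred1 [ffun v => False_rect I (noV v)]) => [|h].
  by rewrite big1 // => v; case: (noV v).
rewrite /=; have -> : (h == [ffun v => False_rect I (noV v)]) = true.
  by apply/eqP/ffunP => v; case: (noV v).
by apply/andP; split; apply/forallP => v; case: (noV v).
Qed.

Lemma chromsum_cons k s A : chromsum (k :: s) A = addpart x k (chromsum s) A.
Proof.
rewrite /chromsum /addpart /addpart_from (reindex (@ffun_vertex_cons k s)) /=; last first.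
  exact/onW_bij/ffun_vertex_cons_bij.
under [RHS]eq_bigr do rewrite set0U mulr_sumr.
rewrite pair_big_dep /=; apply: eq_big => [[g h]|[g h] _] /=; last first.
  rewrite big_vertex_cons; congr (_ * _); apply: eq_bigr => v _.
    by rewrite ffunE.
  by rewrite ffunE vertex_cons_fun_behead.
apply/andP/andP => [[/forallP hP /forallP hA]|[/forallP gA /andP[/forallP hP /forallP hA]]].
  split; first by apply/forallP => p; have := hA (vertex_head s p); rewrite ffunE.
  apply/andP; split.
    apply/forallP => u; apply/forallP => v; apply/implyP => uv.
    have /forallP/(_ (vertex_behead k v))/implyP := hP (vertex_behead k u).
    rewrite !tag_vertex_behead (inj_eq lift_inj) !ffunE !vertex_cons_fun_behead; exact.
  apply/forallP => v; have := hA (vertex_behead k v).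
  rewrite ffunE vertex_cons_fun_behead inE => ->; rewrite andbT.
  apply/imsetP => -[p _ hv].
  have /forallP/(_ (vertex_behead k v))/implyP := hP (vertex_head s p).
  rewrite tag_vertex_behead !ffunE vertex_cons_fun_behead /= hv eqxx => /(_ isT).
  by [].
have gh p v : g p != h v.
  have := hA v; rewrite inE => /andP[/imsetP nhv _].
  by apply/eqP => gpv; case: nhv; exists p.
split; apply/forallP; last first.
  apply: vertex_consP => [p|v]; first by rewrite ffunE /= gA.
  rewrite ffunE vertex_cons_fun_behead.
  by have := hA v; rewrite inE => /andP[].
apply: vertex_consP => u; apply/forallP; apply: vertex_consP => v; apply/implyP;
  rewrite !ffunE ?tag_vertex_behead ?vertex_cons_fun_behead ?(inj_eq lift_inj) //=.
- by rewrite eq_sym.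
- by have /forallP/(_ v)/implyP := hP u.
Qed.

Lemma eq_addpart k f g A : f =1 g -> addpart x k f A = addpart x k g A.
Proof. by move=> fg; apply: eq_bigr => h _; rewrite fg. Qed.

Lemma chromsum_single n A : chromsum [:: n] A = esum x 1 A ^+ n.
Proof.
rewrite chromsum_cons esum1 -[in RHS](card_ord n) -prodr_const.
rewrite (bigA_distr_big _ (fun _ c => x c)) /=.
apply: eq_big => [g|g _]; last by rewrite chromsum_nil mulr1.
by apply/forallP/ffun_onP.
Qed.

End ChromSum.

Lemma chrom_truncE (la : intpart) N :
  chrom_trunc (complete_multipartite la) N = chromsum (@var N) la setT.
Proof.
apply: eq_bigl => h; rewrite -[LHS]andbT; congr (_ && _).
by apply/esym/forallP => v; rewrite in_setT.
Qed.

Lemma esum_setT N k : esum (@var N) k setT = mesym N rat k.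
Proof. by apply: eq_bigl => B; rewrite subsetT. Qed.

(** * From cone membership to e-positivity, and the positive cases *)

Lemma intpart_of_subproof (mu : seq nat) : is_intpart (sort geq [seq k <- mu | k != 0%N]).
Proof.
rewrite /is_intpart mem_sort mem_filter eqxx andbT; apply: sort_sorted => a b.
exact: leq_total.
Qed.

Definition intpart_of (mu : seq nat) : intpart := IntPart (intpart_of_subproof mu).

Lemma elem_symfun_intpart_of mu N : elem_symfun (intpart_of mu) N = elem_fam mu setT.
Proof.
rewrite /elem_fam /= /elem_trunc /= (perm_big _ (permEl (perm_sort _ _))) big_filter.
rewrite big_mkcond; apply: eq_bigr => k _; rewrite esum_setT.
by case: eqVneq => // ->; rewrite mesym0E.
Qed.

Lemma cone_e_positive P (f : setfam) (F : symfun) :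
  cone P f -> (forall N, F N = f N setT) -> e_positive F.
Proof.
move=> /cone_seq[s fE] FE; pose t := [seq intpart_of mu | mu <- s].
pose c : {fsfun intpart -> rat with 0} :=
  [fsfun nu in [fset nu | nu in t]%fset => (count_mem nu t)%:R].
have cE nu : c nu = (count_mem nu t)%:R.
  by rewrite fsfunE !inE /=; case: ifPn => // /count_memPn ->.
exists c => [N|nu]; last by rewrite cE.
rewrite FE fE (perm_big (undup t)) /=; last first.
  apply: uniq_perm; rewrite ?fset_uniq ?undup_uniq // => nu.
  by rewrite mem_finsupp cE mem_undup pnatr_eq0 -lt0n -has_count has_pred1.
transitivity (\sum_(nu <- t) elem_symfun nu N).
  by rewrite big_map; apply: eq_bigr => mu _; rewrite elem_symfun_intpart_of.
rewrite -big_undup_iterop_count; apply: eq_bigr => nu _.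
by rewrite cE scaler_nat Monoid.iteropE iter_addr_0.
Qed.

Definition fam_chromsum (s : seq nat) : setfam := fun N A => chromsum (@var N) s A.

Lemma e_positive_chromatic P (la : intpart) :
  cone P (fam_chromsum la) -> e_positive (chromatic_symfun (complete_multipartite la)).
Proof. by move/cone_e_positive; apply => N; exact: chrom_truncE. Qed.

Lemma cone_chromsum_single n : cone everything (fam_chromsum [:: n]).
Proof.
apply: cone_ext (@cone_elem everything (nseq n 1%N) isT) => N A.
by rewrite /fam_chromsum chromsum_single /elem_fam big_nseq iter_mulr_1.
Qed.

Lemma cone_chromsum12 s : (forall k, k \in s -> k = 1%N \/ k = 2%N) ->
  cone two_rowed (fam_chromsum s).
Proof.
elim: s => [_|k s IHs ks].
  apply: cone_ext (cone_eprod 0 0) => N A.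
  by rewrite /fam_eprod /eprod esum0 mulr1 /fam_chromsum chromsum_nil.
have {}IHs : cone two_rowed (fam_chromsum s).
  by apply: IHs => j js; apply: ks; rewrite inE js orbT.
case: (ks k (mem_head k s)) => ->.
  apply: cone_ext (cone_wsum1 IHs) => N A.
  by rewrite /fam_chromsum chromsum_cons addpart1.
apply: cone_ext (cone_add2 IHs) => N A.
by rewrite /fam_chromsum chromsum_cons addpart2.
Qed.

Lemma chromsum_nseq2 (I : finType) (R : comNzRingType) (x : I -> R) n A :
  chromsum x (nseq n 2%N) A = iter n (add2 x) (fun=> 1) A.
Proof.
elim: n A => [|n IHn] A; first exact: chromsum_nil.
by rewrite chromsum_cons (eq_addpart _ _ _ IHn) addpart2.
Qed.

Lemma cone_chromsum3 n : (0 < n)%N -> cone everything (fam_chromsum (3%N :: nseq n 2%N)).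
Proof.
move=> n0; apply: cone_ext (cone_add3_iter n0) => N A.
by rewrite /fam_chromsum chromsum_cons (eq_addpart _ _ _ (@chromsum_nseq2 _ _ _ n)) addpart3.
Qed.

(** * Supports of e-positive functions *)

Section RobinHood.
Variable N : nat.
Implicit Types (p q : {mpoly rat[N]}) (m : 'X_{1..N}).

Definition coef_nonneg p := forall m, 0 <= p@_m.

Lemma mcoeffM_gt0 p q m : coef_nonneg p -> coef_nonneg q ->
  0 < (p * q)@_m <-> exists m1 m2, [/\ m = (m1 + m2)%MM, 0 < p@_m1 & 0 < q@_m2].
Proof.
move=> p0 q0; rewrite mcoeffM; split=> [|[m1 [m2 [-> p1 q2]]]].
  move/lt0r_neq0; rewrite psumr_neq0 => [|k _]; last exact: mulr_ge0.
  case/hasP=> -[m1 m2] _ /= /andP[/eqP mE pq]; exists m1, m2; split=> //; rewrite lt_neqAle ?p0 ?q0 andbT eq_sym;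
    by apply: contraTneq pq => ->; rewrite ?mul0r ?mulr0 ltxx.
have d1 : (mdeg m1 < (mdeg (m1 + m2)).+1)%N by rewrite ltnS mdegD leq_addr.
have d2 : (mdeg m2 < (mdeg (m1 + m2)).+1)%N by rewrite ltnS mdegD leq_addl.
rewrite (bigD1 (BMultinom d1, BMultinom d2)) //= ltr_pwDl ?mulr_gt0 //.
by apply: sumr_ge0 => k _; exact: mulr_ge0.
Qed.

Lemma coef_nonnegM p q : coef_nonneg p -> coef_nonneg q -> coef_nonneg (p * q).
Proof. by move=> p0 q0 m; rewrite mcoeffM sumr_ge0 // => k _; rewrite mulr_ge0. Qed.

(** These are the balancing transfers of the dominance order; when m i = m j + 1 the transfer merely
    swaps the two exponents. *)
Definition robin_hood p :=
  forall m i j, (m j < m i)%N -> 0 < p@_m -> 0 < p@_(m - U_(i) + U_(j))%MM.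

(** If m1 + m2 is larger at i than at j, then so is m1 or m2, and the transfer is made in that
    factor. *)
Lemma robin_hoodM p q : coef_nonneg p -> coef_nonneg q ->
  robin_hood p -> robin_hood q -> robin_hood (p * q).
Proof.
move=> p0 q0 rp rq m i j mji /(mcoeffM_gt0 _ p0 q0)[m1 [m2 [mE p1 q2]]].
apply/(mcoeffM_gt0 _ p0 q0); subst m; move: mji; rewrite !mnmDE => mji.
have [m1ji|m1ij] := ltnP (m1 j) (m1 i).
  exists (m1 - U_(i) + U_(j))%MM, m2; split=> //; last exact: rp.
  by apply/mnmP => c; rewrite !(mnmDE, mnmBE, mnm1E); case: (eqVneq i c) => [<-|_] /=; lia.
have m2ji : (m2 j < m2 i)%N by lia.
exists m1, (m2 - U_(i) + U_(j))%MM; split=> //; last exact: rq.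
by apply/mnmP => c; rewrite !(mnmDE, mnmBE, mnm1E); case: (eqVneq i c) => [<-|_] /=; lia.
Qed.

Lemma coef_nonneg_mesym k : coef_nonneg (mesym N rat k).
Proof. by move=> m; rewrite mcoeff_mesym ler0n. Qed.

Lemma robin_hood_mesym k : robin_hood (mesym N rat k).
Proof.
move=> m i j mji; rewrite !mcoeff_mesym !ltr0n !lt0b /mechar.
case/andP=> /eqP dm /forallP m1.
have mi : m i = 1%N by have := m1 i; lia.
have mj : m j = 0%N by lia.
have ji : j != i by apply: contraTneq mji => ->; rewrite ltnn.
have le_m : (U_(i) <= m)%MM by rewrite lep1mP mi.
have := congr1 mdeg (submK le_m); rewrite !mdegD !mdeg1 dm => ->; rewrite eqxx /=.
apply/forallP => c; have := m1 c; rewrite !(mnmDE, mnmBE, mnm1E).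
by have [<-|_] := eqVneq j c; rewrite ?mj; lia.
Qed.

Lemma elem_trunc_robin_hood (mu : intpart) :
  coef_nonneg (elem_trunc mu N) /\ robin_hood (elem_trunc mu N).
Proof.
rewrite /elem_trunc; elim: (parts mu) => [|k s [IH0 IHr]].
  rewrite big_nil -(mesym0E N rat).
  by split; [exact: coef_nonneg_mesym | exact: robin_hood_mesym].
rewrite big_cons; split; first exact: coef_nonnegM (coef_nonneg_mesym k) IH0.
exact: robin_hoodM (coef_nonneg_mesym k) IH0 (@robin_hood_mesym k) IHr.
Qed.

End RobinHood.

Lemma e_positive_robin_hood (f : symfun) N : e_positive f -> robin_hood (f N).
Proof.
case=> c fE c0 m i j mji; rewrite fE !raddf_sum /=.
under eq_bigr do rewrite mcoeffZ.
under [X in _ -> 0 < X]eq_bigr do rewrite mcoeffZ.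
have e0 mu m' : 0 <= c mu * (elem_trunc mu N)@_m'.
  by rewrite mulr_ge0 //; case: (elem_trunc_robin_hood N mu).
move/lt0r_neq0; rewrite psumr_neq0 // => /hasP[mu mu_c /= cm].
rewrite lt_neqAle sumr_ge0 // andbT eq_sym psumr_neq0 //; apply/hasP; exists mu => //=.
have cmu : 0 < c mu by rewrite lt_neqAle c0 andbT eq_sym; apply: contraTneq cm => ->; rewrite mul0r ltxx.
rewrite mulr_gt0 //; apply: (elem_trunc_robin_hood N mu).2 => //.
by move: cm; rewrite pmulr_rgt0.
Qed.

(** * Monomials of X as sizes of colour classes *)

Section ColorClasses.
Variable la : intpart.
Local Notation l := (size la).
Local Notation V := (cm_vertices la).
Local Notation vertex i p := (existT (fun i : 'I_l => 'I_(nth 0%N la i)) i p).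

Lemma nth_intpart_gt0 i : (i < l)%N -> (0 < nth 0%N la i)%N.
Proof.
move=> il; have /andP[_] := parts_intpart la.
by rewrite lt0n; apply: contraNneq => <-; exact: mem_nth.
Qed.

Lemma chrom_trunc_gt0 N m :
  0 < (chrom_trunc (complete_multipartite la) N)@_m <->
  exists2 h : {ffun V -> 'I_N}, cm_proper h & m = (\sum_v U_(h v))%MM.
Proof.
have cE (h : {ffun V -> 'I_N}) : (\prod_v 'X_(h v) : {mpoly rat[N]})@_m =
    ((\sum_v U_(h v))%MM == m)%:R by rewrite mprodXE mcoeffX.
rewrite /chrom_trunc raddf_sum /=; split=> [/lt0r_neq0|[h hp mE]].
  rewrite psumr_neq0 => [|h _]; last by rewrite cE ler0n.
  by case/hasP=> h _ /andP[hp]; rewrite cE ltr0n lt0b => /eqP <-; exists h.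
rewrite (bigD1 h) //= cE -mE eqxx ltr_pwDl // sumr_ge0 // => g _.
by rewrite cE ler0n.
Qed.

Lemma color_class_size N (h : {ffun V -> 'I_N}) c :
  (\sum_v U_(h v))%MM c = (\sum_(i < l) \sum_(p < nth 0 la i) (h (vertex i p) == c))%N.
Proof.
rewrite mnm_sumE sig_big_dep /=; apply: eq_bigr => -[i p] _.
by rewrite mnm1E.
Qed.

Lemma chrom_trunc_parts_gt0 N : (l <= N)%N ->
  0 < (chrom_trunc (complete_multipartite la) N)@_[multinom nth 0%N la c | c < N].
Proof.
move=> lN; apply/chrom_trunc_gt0; pose h := [ffun v : V => widen_ord lN (tag v)].
exists h => [|]; first by do 2![apply/forallP => ?]; apply/implyP; rewrite !ffunE.
apply/mnmP => c; rewrite color_class_size mnmE.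
have hE i p : (h (vertex i p) == c) = (i == c :> nat) by rewrite ffunE.
under eq_bigr => i _ do [under eq_bigr do rewrite hE; rewrite sum_nat_const card_ord].
have [cl|lc] := ltnP c l; last first.
  rewrite nth_default // big1 // => i _.
  by rewrite (_ : (_ == _) = false) ?muln0 //; have := ltn_ord i; lia.
rewrite (bigD1 (Ordinal cl)) //= eqxx muln1 big1 ?addn0 // => i.
by rewrite -val_eqE /= => /negbTE ->; rewrite muln0.
Qed.

Lemma card_part_sizes N (P : pred nat) : ~~ P 0%N -> (l <= N)%N ->
  #|[set c : 'I_N | P (nth 0%N la c)]| = count P la.
Proof.
move=> P0 lN; rewrite cardsE -sum1_card -sum1_count (big_nth 0%N) big_mkord.
rewrite (big_ord_widen_cond N (fun c => P (nth 0%N la c)) (fun=> 1%N) lN).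
apply: eq_bigl => c; rewrite unfold_in; have [cl|lc] := ltnP c l; rewrite ?andbT ?andbF //.
by rewrite nth_default // (negbTE P0).
Qed.

(* At most [N - l] parts receive two or more colours.                           *)
Lemma count_color_classes N m (P : pred nat) :
  0 < (chrom_trunc (complete_multipartite la) N)@_m ->
  (count P la + l <= #|[set c : 'I_N | P (m c)]| + N)%N.
Proof.
case/chrom_trunc_gt0 => h /forallP hp ->.
have proper u v : tag u != tag v -> h u != h v by move: (hp u) => /forallP/(_ v)/implyP.
pose rep (i : 'I_l) : V := vertex i (Ordinal (nth_intpart_gt0 (ltn_ord i))).
have rep_inj : injective (h \o rep).
  by move=> i j /eqP; apply: contraTeq => ij; exact: proper.
(* The colour k i is that of part i if the part is monochromatic; otherwise it is one of its colours
   that is not the colour of any representative, and only N - l such colours exist. *)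
have /fin_all_exists[k kP] (i : 'I_l) : exists c, (exists p, h (vertex i p) = c) /\
    (P (nth 0%N la i) -> P ((\sum_v U_(h v))%MM c) \/ c \notin codom (h \o rep)).
  have [/forallP hi|/forallPn[p hp_i]] := boolP [forall p, h (vertex i p) == h (rep i)].
    exists (h (rep i)); split; first by eexists.
    move=> Pi; left; rewrite color_class_size (bigD1 i) //= [X in (_ + X)%N]big1 => [|j ji]; last first.
      by rewrite big1 // => p _; rewrite (negbTE (proper _ _ _)).
    by under eq_bigr => p _ do rewrite hi; rewrite sum_nat_const card_ord muln1 addn0.
  exists (h (vertex i p)); split; first by exists p.
  move=> _; right; apply: contraNN hp_i => /codomP[j /= hj].
  have [ij|ij] := eqVneq i j; first by rewrite hj ij.
  by have := proper (vertex i p) (rep j) ij; rewrite hj eqxx.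
have k_inj : injective k.
  move=> i j /eqP; apply: contraTeq => ij.
  have [[[p <-] _] [[q <-] _]] := (kP i, kP j); exact: proper.
have countE : count P la = #|[set i : 'I_l | P (nth 0%N la i)]|.
  by rewrite cardsE -sum1_card -sum1_count (big_nth 0%N) big_mkord.
have sub : k @: [set i : 'I_l | P (nth 0%N la i)] \subset
    [set c : 'I_N | P ((\sum_v U_(h v))%MM c)] :|: ~: [set c in codom (h \o rep)].
  apply/subsetP => _ /imsetP[i + ->]; rewrite !inE => Pi.
  by have [_ /(_ Pi)[->|->]] := kP i; rewrite ?orbT.
have := leq_trans (subset_leq_card sub) (leq_card_setU _ _).
rewrite countE card_imset // => leP.
have := cardsC [set c in codom (h \o rep)].
by rewrite cardsE card_codom // !card_ord; lia.
Qed.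
End ColorClasses.

(** * Partitions excluded by transfers *)

Section NegativeCases.
Variable la : intpart.
Local Notation l := (size la).
Local Notation X := (chromatic_symfun (complete_multipartite la)).
Hypothesis Xpos : e_positive X.

Let part_exps N : 'X_{1..N} := [multinom nth 0%N la c | c < N].

(** With l colours every part is monochromatic, so no part size can be lost; a transfer from a to b
    <= a-2 leaves one exponent a fewer. *)
Lemma part_lt_add2 i j : (i < l)%N -> (j < l)%N -> (nth 0%N la i < nth 0%N la j + 2)%N.
Proof.
move=> il jl; rewrite ltnNge; apply/negP => ji.
pose a := nth 0%N la i; pose oi := Ordinal il; pose oj := Ordinal jl.
have lt_ji : (part_exps l oj < part_exps l oi)%N by rewrite !mnmE /=; lia.
have := count_color_classes (pred1 a)
  (e_positive_robin_hood Xpos lt_ji (chrom_trunc_parts_gt0 (leqnn l))).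
apply/negP; rewrite -ltnNge ltn_add2r -(@card_part_sizes la l) //; last by rewrite /a /=; lia.
apply: proper_card; apply/properP; split; last first.
  exists oi; rewrite !inE ?mnmDE ?mnmBE ?mnm1E ?mnmE /= ?eqxx //.
  rewrite /a; case: (eqVneq oj oi) => [[eji]|_]; last by lia.
  by move: ji; rewrite eji; lia.
apply/subsetP => c; rewrite !inE mnmDE mnmBE !mnm1E mnmE /=.
case: (eqVneq oi c) => [<-|_]; case: (eqVneq oj _) => [e|_] /=; rewrite ?subn0 ?addn0 //.
by rewrite -e /a /=; lia.
Qed.

(** With l + 1 colours at most one part is split, so at most one size satisfying P can be lost,
    whereas m loses two. *)
Lemma two_parts_contra (P : pred nat) (m : 'X_{1..l.+1}) (i j : 'I_l.+1) :
  0 < (X l.+1)@_m -> ~~ P 0%N -> i != j ->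
  P (part_exps l.+1 i) -> P (part_exps l.+1 j) ->
  (forall c, P (m c) -> [/\ P (part_exps l.+1 c), c != i & c != j]) -> False.
Proof.
move=> /(count_color_classes P) m0 P0 ij Pi Pj sub; move: m0; apply/negP.
rewrite -ltnNge addnS -addSn ltn_add2r -(card_part_sizes P0 (leqnSn l)).
rewrite !mnmE in Pi Pj.
rewrite [X in (_ < X)%N](cardsD1 i) [X in (_ < _ + X)%N](cardsD1 j) !inE Pi Pj eq_sym ij.
rewrite !add1n !ltnS; apply: subset_leq_card; apply/subsetP => c; rewrite !inE.
by case/sub; rewrite mnmE => -> -> ->.
Qed.

(** The transfers (k,k,0) -> (k-1,k,1) -> (k-1,k-1,2) destroy two exponents k, and for k >= 3 the
    new 2 restores none. *)
Lemma equal_parts_le2 i j : (i < j)%N -> (j < l)%N ->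
  nth 0%N la i = nth 0%N la j -> (nth 0%N la i <= 2)%N.
Proof.
move=> ij jl eij; rewrite leqNgt; apply/negP => k3.
have il : (i < l.+1)%N by lia. have jl' : (j < l.+1)%N by lia.
pose oi := Ordinal il; pose oj := Ordinal jl'; pose o : 'I_l.+1 := ord_max.
pose m := part_exps l.+1; pose m1 := (m - U_(oi) + U_(o))%MM.
pose m2 := (m1 - U_(oj) + U_(o))%MM.
have eqij : (oi == oj) = false by rewrite -val_eqE /=; lia.
have eqio : (oi == o) = false by rewrite -val_eqE /=; lia.
have eqjo : (oj == o) = false by rewrite -val_eqE /=; lia.
have eqs := (eqij, eqio, eqjo, eq_sym oj oi, eq_sym o oi, eq_sym o oj, eqxx).
have mo : nth 0%N la l = 0%N by rewrite nth_default.
have m0P := chrom_trunc_parts_gt0 (leqnSn l).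
have lt1 : (m o < m oi)%N by rewrite !mnmE /= mo; lia.
have m1P := e_positive_robin_hood Xpos lt1 m0P.
have lt2 : (m1 o < m1 oj)%N.
  by rewrite !(mnmDE, mnmBE, mnm1E) !mnmE /= mo !eqs; lia.
have m2P := e_positive_robin_hood Xpos lt2 m1P.
apply: (@two_parts_contra (pred1 (nth 0%N la i)) m2 oi oj) => //=.
- by rewrite neq_ltn; lia.
- by rewrite eqij.
- by rewrite mnmE.
- by rewrite mnmE /= eij.
move=> c; rewrite !(mnmDE, mnmBE, mnm1E) !mnmE.
have [<-|ci] := eqVneq oi c; first by rewrite !eqs /=; lia.
have [<-|cj] := eqVneq oj c; first by rewrite !eqs /=; lia.
have [<-|co] := eqVneq o c; first by rewrite /= mo; lia.
by rewrite !subn0 !addn0 => ->.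
Qed.

(** The transfers (k+1,k,0) -> (k,k,1) -> (k,k-1,2) -> (k-1,k-1,3) end, for k >= 4, with no exponent
    in {k, k+1}. *)
Lemma consecutive_parts_le4 k : parts la = [:: k.+1; k] -> (k <= 3)%N.
Proof.
move=> laE; rewrite leqNgt; apply/negP => k4.
have l2 : l = 2%N by rewrite laE.
pose m := part_exps l.+1.
pose o i : 'I_l.+1 := inord i.
have oE i : (i < 3)%N -> val (o i) = i by move=> i3; apply: inordK; rewrite l2.
have o0 := oE 0%N isT; have o1 := oE 1%N isT; have o2 := oE 2%N isT.
have mE c : m c = nth 0%N [:: k.+1; k] c by rewrite mnmE; move: (nat_of_ord c) => i; rewrite laE.
have eqs i j : (i < 3)%N -> (j < 3)%N -> (o i == o j) = (i == j).
  by move=> i3 j3; rewrite -val_eqE /= !oE.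
have o_cases (c : 'I_l.+1) : [\/ c = o 0%N, c = o 1%N | c = o 2%N].
  have := ltn_ord c; rewrite [X in (_ < X.+1)%N]l2 => c3.
  case vc: (nat_of_ord c) c3 => [|[|[|//]]] _; [constructor 1|constructor 2|constructor 3];
    by apply: val_inj; rewrite /= vc (o0, o1, o2).
pose m1 := (m - U_(o 0%N) + U_(o 2%N))%MM.
pose m2 := (m1 - U_(o 1%N) + U_(o 2%N))%MM.
pose m3 := (m2 - U_(o 0%N) + U_(o 2%N))%MM.
have m0P := chrom_trunc_parts_gt0 (leqnSn l).
have simp := (mnmDE, mnmBE, mnm1E, mE, eqs, o0, o1, o2).
have lt1 : (m (o 2%N) < m (o 0%N))%N by rewrite !simp.
have m1P := e_positive_robin_hood Xpos lt1 m0P.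
have lt2 : (m1 (o 2%N) < m1 (o 1%N))%N by rewrite !simp //=; lia.
have m2P := e_positive_robin_hood Xpos lt2 m1P.
have lt3 : (m2 (o 2%N) < m2 (o 0%N))%N by rewrite !simp //=; lia.
have m3P := e_positive_robin_hood Xpos lt3 m2P.
apply: (@two_parts_contra (fun n => (n == k) || (n == k.+1)) m3 (o 0%N) (o 1%N)) => //.
- by lia.
- by rewrite eqs.
- by rewrite -/m mE o0 /= eqxx orbT.
- by rewrite -/m mE o1 /= eqxx.
by move=> c; case: (o_cases c) => ->; rewrite !simp //=; lia.
Qed.

End NegativeCases.

(** * The partition (4,3) and the classification *)

Section Ones.
Variable R : comNzRingType.

Lemma esum_ones (I : finType) k (A : {set I}) :
  esum (fun=> 1 : R) k A = 'C(#|A|, k)%:R.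
Proof.
rewrite /esum -cards_draws -sum1_card natr_sum; apply: eq_big => [B|B _].
  by rewrite inE.
by rewrite big1.
Qed.

(* The number of ways to finish a part by colouring [k] more vertices, when [d] *)
(* of the [a] colours already occur in that part, weighted by [phi].            *)
Fixpoint count_from (phi : nat -> nat) k d a : nat :=
  if k is k'.+1 then d * count_from phi k' d a + (a - d) * count_from phi k' d.+1 a
  else phi (a - d)%N.

Lemma addpart_from_ones (I : finType) (f : {set I} -> R) phi k (D A : {set I}) :
  (forall B, f B = (phi #|B|)%:R) -> D \subset A ->
  addpart_from (fun=> 1) D k f A = (count_from phi k #|D| #|A|)%:R.
Proof.
move=> fE; elim: k D => [|k IHk] D DA; first by rewrite addpart_from0 fE cardsDS.
rewrite addpart_fromS (big_setID D) /= (setIidPr DA) natrD !natrM; congr (_ + _).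
  rewrite -IHk // -sumr_const mulr_suml; apply: eq_bigr => c cD.
  by rewrite (setUidPr _) // sub1set.
rewrite -cardsDS // -sumr_const mulr_suml; apply: eq_bigr => c.
rewrite inE => /andP[cD cA].
by rewrite IHk ?cardsU1 ?cD // subUset sub1set cA.
Qed.

End Ones.

Lemma meval_esum N k A : (esum (@var N) k A).@[fun=> 1] = esum (fun=> 1) k A.
Proof.
rewrite /esum rmorph_sum; apply: eq_bigr => B _; rewrite rmorph_prod.
by apply: eq_bigr => c _; rewrite /= /var mevalXU.
Qed.

Lemma meval_chromsum N s A : (chromsum (@var N) s A).@[fun=> 1] = chromsum (fun=> 1) s A.
Proof.
rewrite /chromsum rmorph_sum; apply: eq_bigr => B _; rewrite rmorph_prod.
by apply: eq_bigr => c _; rewrite /= /var mevalXU.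
Qed.

Lemma chromsum_pair_ones N a b : chromsum (fun=> 1) [:: a; b] [set: 'I_N] =
  (count_from (expn^~ b) a 0 N)%:R :> rat.
Proof.
rewrite chromsum_cons /addpart (@addpart_from_ones _ _ _ (expn^~ b)) ?sub0set //.
  by rewrite cards0 cardsT card_ord.
by move=> B; rewrite chromsum_single esum_ones bin1 natrX.
Qed.

Lemma meval_elem_trunc (mu : intpart) N :
  (elem_trunc mu N).@[fun=> 1] = (\prod_(k <- mu) 'C(N, k))%:R.
Proof.
rewrite /elem_trunc rmorph_prod natr_prod; apply: eq_bigr => k _.
by rewrite /= -esum_setT meval_esum esum_ones cardsT card_ord.
Qed.

(** Each e_1 contributes x_0 and each e_2 contributes x_0 x_1. *)
Lemma elem_trunc2_gt0 (mu : intpart) : all (fun k => (0 < k < 3)%N) mu ->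
  0 < (elem_trunc mu 2)@_[multinom (if c == 0 :> nat then size mu else count_mem 2%N mu) | c < 2].
Proof.
rewrite /elem_trunc; elim: (parts mu) => [|k s IHs] /=.
  move=> _; rewrite big_nil mcoeff1 (_ : _ == _) //; apply/eqP/mnmP => c.
  by rewrite mnmE mnm0E; case: ifP.
case/andP=> k3 /IHs s_gt0; rewrite big_cons; apply/mcoeffM_gt0.
- exact: coef_nonneg_mesym.
- elim: (s) => [|j t IHt]; first by rewrite big_nil -(mesym0E 2 rat); exact: coef_nonneg_mesym.
  by rewrite big_cons; apply: coef_nonnegM => //; exact: coef_nonneg_mesym.
pose m1 : 'X_{1..2} := [multinom (if c == 0 :> nat then 1 else k == 2 : nat)%N | c < 2].
eexists m1, _; split; [|rewrite mcoeff_mesym ltr0n lt0b /mechar|exact: s_gt0].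
  apply/mnmP => c; rewrite !(mnmDE, mnmE); case: ifP => _; first by rewrite add1n.
  by [].
rewrite mdegE !big_ord_recl big_ord0 !mnmE /=; apply/andP; split.
  by case: k k3 {m1} => [|[|[|]]].
by apply/forallP => c; rewrite mnmE; case: ifP => // _; case: (k == 2).
Qed.

(** A mu with a part above 2 has e_mu(1,1) = 0. Any other mu that occurs must be (2,2,2,1), with
    values 2 at (1,1) and 81 at (1,1,1). Positivity would thus give 2 X(1,1,1) >= 81 X(1,1), that is
    132 >= 162. *)
Lemma not_e_positive43 (la : intpart) : parts la = [:: 4; 3]%N ->
  ~ e_positive (chromatic_symfun (complete_multipartite la)).
Proof.
move=> laE [c cE c_ge0].
have evX N : \sum_(mu <- finsupp c) c mu * (\prod_(k <- mu) 'C(N, k))%:R =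
    (count_from (expn^~ 3%N) 4 0 N)%:R.
  have := congr1 (meval (fun=> 1)) (cE N).
  rewrite /= chrom_truncE meval_chromsum laE chromsum_pair_ones => ->.
  rewrite rmorph_sum; apply: eq_bigr => mu _.
  by rewrite /= mevalZ meval_elem_trunc.
have term mu : 0 <= c mu *
    (2 * (\prod_(k <- mu) 'C(3, k))%:R - 81 * (\prod_(k <- mu) 'C(2, k))%:R).
  have [->|c_neq0] := eqVneq (c mu) 0; first by rewrite mul0r.
  have c_gt0 : 0 < c mu by rewrite lt_neqAle eq_sym c_neq0 c_ge0.
  rewrite pmulr_rge0 // subr_ge0 -!natrM ler_nat.
  have [mu12|] := boolP (all (fun k => (0 < k < 3)%N) mu); last first.
    case/allPn=> k k_mu; have /andP[_ mu0] := parts_intpart mu.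
    have k0 : (0 < k)%N by rewrite lt0n; apply: contraNneq mu0 => <-.
    by rewrite k0 -leqNgt (big_rem k k_mu) /= => k3; rewrite [in leqLHS]bin_small ?mul0n ?muln0.
  set m := [multinom (if c == 0 :> nat then size mu else count_mem 2%N mu) | c < 2].
  have : 0 < (chromatic_symfun (complete_multipartite la) 2)@_m.
    rewrite cE raddf_sum; have mu_c : mu \in finsupp c by rewrite mem_finsupp.
    rewrite (big_fsetD1 mu) //= mcoeffZ ltr_pwDl ?mulr_gt0 ?elem_trunc2_gt0 //.
    apply: sumr_ge0 => nu _; rewrite mcoeffZ mulr_ge0 //.
    by have [] := elem_trunc_robin_hood 2 nu.
  move=> m_gt0.
  (* Two colours leave both parts monochromatic, so the exponents of m are 4 and 3; [le_sz] decides
     their order. *)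
  have := (count_color_classes (pred1 4%N) m_gt0, count_color_classes (pred1 3%N) m_gt0).
  rewrite laE !leq_add2r => -[/card_gt0P[i] + /card_gt0P[j]].
  rewrite !inE !mnmE => iP jP.
  have le_sz : (count_mem 2%N mu <= size mu)%N := count_size _ _.
  have [sz c2] : size mu = 4%N /\ count_mem 2%N mu = 3%N.
    by move: iP jP; case: ifP => _ /eqP iP; case: ifP => _ /eqP jP; lia.
  have prodC : ((\prod_(k <- mu) 'C(2, k)) * 2 ^ count_mem 2 mu = 2 ^ size mu /\
      \prod_(k <- mu) 'C(3, k) = 3 ^ size mu)%N.
    elim: (parts mu) mu12 {m m_gt0 c_neq0 c_gt0 iP jP le_sz sz c2} => [|k s IHs] /=.
      by rewrite !big_nil.
    case/andP=> k3 /IHs[IH2 IH3]; rewrite !big_cons expnD !expnS -IH2 -IH3.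
    by case: k k3 => [|[|[|]]] //= _; split; rewrite ?bin1 ?binn ?expn0 ?expn1 //; nia.
  by move: prodC; rewrite sz c2 => -[]; lia.
have : 0 <= \sum_(mu <- finsupp c) c mu *
    (2 * (\prod_(k <- mu) 'C(3, k))%:R - 81 * (\prod_(k <- mu) 'C(2, k))%:R).
  by apply: sumr_ge0.
under eq_bigr do rewrite mulrBr !(mulrCA (c _)).
rewrite sumrB -!mulr_sumr !evX; apply/negP.
by [].
Qed.

Theorem corollary1p3 (la : intpart) (la_gt0 : (0 < sumn la)%N) :
  e_positive (chromatic_symfun (complete_multipartite la)) <->
  [\/ size la = 1%N,
      (forall k : nat, k \in parts la -> k = 1%N \/ k = 2%N) |
      (exists2 beta : nat, (1 <= beta)%N & parts la = 3%N :: nseq beta 2%N)].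
Proof.
split=> [Xpos|]; last first.
  case=> [la1|la12|[n n0 laE]].
  - case laE: (parts la) la1 => [|n []] // _.
    by apply: (@e_positive_chromatic predT); rewrite laE; exact: cone_chromsum_single.
  - by apply: (@e_positive_chromatic two_rowed); exact: cone_chromsum12.
  - by apply: (@e_positive_chromatic predT); rewrite laE; exact: cone_chromsum3.
have la_sorted : sorted geq la by case/andP: (parts_intpart la).
have la_pos k : k \in parts la -> (0 < k)%N.
  case/andP: (parts_intpart la) => _ la0 kla.
  by rewrite lt0n; apply: contraNneq la0 => <-.
case laE: (parts la) => [|k s]; first by rewrite laE in la_gt0.
have k_max j : j \in s -> (j <= k)%N.
  move: la_sorted; rewrite laE /= (path_sortedE (fun _ _ _ h1 h2 => leq_trans h2 h1)).
  by case/andP=> /allP h _ /h.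
have [k2|k3] := leqP k 2.
  constructor 2 => j; rewrite inE => jks.
  have : (j <= k)%N by case/orP: jks => [/eqP ->|/k_max].
  by have := la_pos j; rewrite laE inE => /(_ jks); lia.
case: s laE k_max => [|j s] laE k_max; first by constructor 1.
(* Every further part lies between k-1 and k, and a second k is impossible since k > 2. *)
have near i : (i < size (j :: s))%N -> nth 0%N (j :: s) i = k.-1.
  move=> i_s; have i_la : (i.+1 < size la)%N by rewrite laE.
  have la0 : (0 < size la)%N by rewrite laE.
  have := @part_lt_add2 la Xpos 0 i.+1 la0 i_la.
  have := @equal_parts_le2 la Xpos 0 i.+1 isT i_la.
  rewrite laE -[nth _ _ 0]/k -[nth _ _ i.+1]/(nth 0%N (j :: s) i).
  have := k_max _ (mem_nth 0%N i_s); move: (nth _ _ i) => y.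
  by have [ky _ /(_ ky)|ky yk _] := eqVneq k y; lia.
have sE : j :: s = nseq (size s).+1 k.-1.
  apply: (@eq_from_nth _ 0%N) => [|i i_s]; first by rewrite size_nseq.
  by rewrite near // nth_nseq -[(size s).+1]/(size (j :: s)) i_s.
(* From here on k stands for the former k - 1, so the partition is (k+1, k, ..., k). *)
case: k k3 => // k k3 in laE k_max near sE *; rewrite sE /= in laE *.
suff -> : k = 2%N by constructor 3; exists (size s).+1.
case: (size s) laE => [|n] laE /=.
  have := consecutive_parts_le4 Xpos laE; rewrite leq_eqVlt => /orP[/eqP k_eq|]; last by lia.
  by rewrite k_eq in laE; case: (not_e_positive43 laE).
have := @equal_parts_le2 la Xpos 1 2 isT; rewrite laE /= => /(_ isT erefl); lia.
Qed.
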